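(* (1) Let $S\subseteq\mathrm{Gr}^{\ge0}_{k,n}$ be a positroid cell, and suppose that $F$ is a pure rational functionary which vanishes on $Z_S$ for all $Z\in\mathrm{Mat}^{>0}_{n,k+4}$. Then $F$ vanishes on $Z_{\mathrm{pre}_IS}$, $\mathrm{cyc}^{-*}F$ vanishes on $Z_{\mathrm{cyc}\,S}$, and $\mathrm{refl}^*F$ vanishes on $Z_{\mathrm{refl}\,S}$, for all $Z$ (of the appropriate size). (2) Let $S_L\subseteq\mathrm{Gr}^{\ge0}_{k_L,N_L}$ and $S_R\subseteq\mathrm{Gr}^{\ge0}_{k_R,N_R}$ be positroid cells such that $\{a,b,n\}$ is coindependent for $S_L$ and $\{b,c,d,n\}$ is coindependent for $S_R$. Let $F$ be a pure functionary with indices contained in $N_L$ (resp. $N_R$) which vanishes on $Z_{S_L}$ (resp. $Z_{S_R}$) for all $Z$. Then $\Psi_{ac}(F)$ vanishes on $Z_{S_L\bowtie S_R}$ for all $Z$.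
   Context: Grassmannians. For finite $N\subset\mathbb Z_{>0}$, $\mathrm{Gr}_{k,N}$ is the real Grassmannian of $k$-planes in $\mathbb R^N$ (row spans of full-rank $k\times N$ matrices); $\langle I\rangle$ is the maximal minor on columns $I$; $\mathrm{Gr}^{\ge0}_{k,N}$ ($\mathrm{Gr}^{>0}_{k,N}$) consists of points with a representative with all maximal minors $\ge0$ ($>0$); $\mathrm{Gr}_{0,N}$ is a point; $\mathrm{Gr}_{k,n}=\mathrm{Gr}_{k,[n]}$. A positroid cell: nonempty set of points of $\mathrm{Gr}^{\ge0}_{k,N}$ with a prescribed set of nonvanishing Plücker coordinates. $J\subseteq N$ is coindependent for $V\in\mathrm{Gr}_{k,N}$ if some nonzero Plücker coordinate $\langle I\rangle_V$ has $I\cap J=\emptyset$ (all $J$ are coindependent if $k=0$), and coindependent for a cell if it is so for all its points. Amplituhedron. $\mathrm{Mat}^{>0}_{N,k+4}$: real $N\times(k+4)$ matrices (rows $Z_i$) with positive maximal minors; $\tilde Z(\mathrm{rowspan}\,C)=\mathrm{rowspan}(CZ)$; $Z_S=\overline{\tilde Z(S)}$. For $Y\in\mathrm{Gr}_{k,k+4}$, $\langle\!\langle i_1i_2i_3i_4\rangle\!\rangle$ is the determinant of the matrix with rows a representative of $Y$ and $Z_{i_1},\dots,Z_{i_4}$. Functionary: homogeneous polynomial in twistor coordinates; rational functionary: ratio of such; pure: after replacing $\langle\!\langle I\rangle\!\rangle$ by $\langle I\rangle$, a ratio of polynomials in each of which every monomial uses each index the same number of times. Operations. For $N=\{j_1<\dots<j_m\}$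 and a $k\times N$ matrix with columns $v_{j_t}$: $\mathrm{pre}_I$ inserts zero columns at positions $I$ ($I\cap N=\emptyset$); $\mathrm{cyc}$: column $j_1$ becomes $(-1)^{k-1}v_{j_m}$, column $j_t$ becomes $v_{j_{t-1}}$ ($t\ge2$); $\mathrm{refl}$: column $j_t$ becomes $v_{j_{m+1-t}}$ and then the first row is multiplied by $(-1)^{\binom k2}$. On functionaries: $\mathrm{cyc}^{-*}$ replaces $\langle\!\langle j_{t_1}\cdots j_{t_4}\rangle\!\rangle$ by the twistor coordinate with indices $j_{t_1+1},\dots,j_{t_4+1}$ ($j_{m+1}:=j_1$) in increasing order; $\mathrm{refl}^*$ by the one with indices $j_{m+1-t_1},\dots,j_{m+1-t_4}$ in increasing order. BCFW product. Let $N$ be finite, $n=\max N$, $a<b<c<d<n$ in $N$ with $a,b$ consecutive and $c,d,n$ consecutive in $N$, $N_L=\{x\in N:x\le a\}\cup\{b,n\}$, $N_R=\{x\in N:b\le x\le d\}\cup\{n\}$, $k=k_L+k_R+1$. The BCFW map sends $(A,[\alpha:\beta:\gamma:\delta:\varepsilon],B)\in\mathrm{Gr}^{\ge0}_{k_L,N_L}\times\mathrm{Gr}^{>0}_{1,5}\times\mathrm{Gr}^{\ge0}_{k_R,N_R}$ to the row span of the $k\times N$ matrix whose first $k_L$ rows have column $x$ equal to $A_x$ ($x<a$), $A_a+\frac\alpha\beta A_b$ ($x=a$), $A_b$ ($x=b$), $0$ ($b<x<n$), $(-1)^{k_R+1}A_n$ ($x=n$); row $k_L+1$ is $\alpha,\beta,(-1)^{k_R}\gamma,(-1)^{k_R}\delta,(-1)^{k_R}\varepsilon$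 in columns $a,b,c,d,n$ and $0$ elsewhere; last $k_R$ rows have column $x$ equal to $0$ ($x<b$), $B_x$ ($b\le x<c$), $B_c+\frac\gamma\delta(B_d+\frac\delta\varepsilon B_n)$ ($x=c$), $B_d+\frac\delta\varepsilon B_n$ ($x=d$), $B_n$ ($x=n$). Under the coindependence hypotheses, the image $S_L\bowtie S_R$ of $S_L\times\mathrm{Gr}^{>0}_{1,5}\times S_R$ is a positroid cell (the BCFW product). Product promotion. For a functionary $F$ with indices in $N_L$, $\Psi_{ac}(F)$ is obtained by substituting $Z_b\mapsto Z_b-\frac{\langle\!\langle bcdn\rangle\!\rangle}{\langle\!\langle acdn\rangle\!\rangle}Z_a$ in every twistor coordinate and expanding multilinearly; for $F$ with indices in $N_R$, by simultaneously substituting $Z_n\mapsto Z_n-\frac{\langle\!\langle abcn\rangle\!\rangle}{\langle\!\langle abcd\rangle\!\rangle}Z_d+\frac{\langle\!\langle abdn\rangle\!\rangle}{\langle\!\langle abcd\rangle\!\rangle}Z_c$ and $Z_d\mapsto Z_d-\frac{\langle\!\langle abdn\rangle\!\rangle}{\langle\!\langle abcn\rangle\!\rangle}Z_c$. *)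

(* Defs.v *)
From HB Require Import structures.
From mathcomp Require Import all_boot all_order all_algebra finmap.
From mathcomp Require Import all_classical all_reals topology normedtype.
From mathcomp.multinomials Require Export -(notations) monalg.

Set Implicit Arguments.
Unset Strict Implicit.
Unset Printing Implicit Defensive.

Import Order.TTheory GRing.Theory Num.Theory.
Import numFieldNormedType.Exports.

Local Open Scope classical_set_scope.
Local Open Scope ring_scope.
Local Open Scope quotient_scope.

(* Grassmannians: full-rank k x n matrices modulo equality of row spans, with
   the quotient topology. *)

Notation frmx R k n := (set_type [set A : 'M[R]_(k, n) | row_free A]).

Definition same_span (R : realType) (k n : nat) : rel (frmx R k n) :=
  fun A B => (set_val A == set_val B)%MS.

Lemma same_span_refl (R : realType) (k n : nat) : reflexive (@same_span R k n).
Proof. by move=> A; rewrite /same_span submx_refl. Qed.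

Lemma same_span_sym (R : realType) (k n : nat) : symmetric (@same_span R k n).
Proof. by move=> A B; rewrite /same_span andbC. Qed.

Lemma same_span_trans (R : realType) (k n : nat) : transitive (@same_span R k n).
Proof.
move=> B A C /andP[AB BA] /andP[BC CB].
by rewrite /same_span (submx_trans AB BC) (submx_trans CB BA).
Qed.

Canonical same_span_equiv (R : realType) (k n : nat) :=
  EquivRel (@same_span R k n) (@same_span_refl R k n)
           (@same_span_sym R k n) (@same_span_trans R k n).

Definition Gr (R : realType) (k n : nat) : topologicalType :=
  quotient_topology {eq_quot (@same_span R k n)}.

Definition represents (R : realType) (k n : nat)
    (V : Gr R k n) (A : 'M[R]_(k, n)) : Prop :=
  exists2 X : frmx R k n,
    set_val X = A & \pi_(quotient_topology {eq_quot (@same_span R k n)}) X = V.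

(* A k-subset of {0, ..., n-1} is an increasing map 'I_k -> 'I_n, and the
   maximal minor on the columns I is \det (colsub I A). *)

Definition increasing (k n : nat) (I : 'I_k -> 'I_n) : Prop :=
  forall i j : 'I_k, (i < j)%N -> (I i < I j)%N.

Definition nonneg_minors (R : realType) (k n : nat) (A : 'M[R]_(k, n)) : Prop :=
  forall I : 'I_k -> 'I_n, increasing I -> 0 <= \det (colsub I A).

Definition positroid_cell (R : realType) (k n : nat) (S : set (Gr R k n)) : Prop :=
  S !=set0 /\
  exists M : set ('I_k -> 'I_n),
    S = [set V | exists A, [/\ represents V A, nonneg_minors A &
           forall I, increasing I -> (\det (colsub I A) != 0 <-> M I)]].

(* A finite set N = {j_1 < ... < j_m} of positive integers is the list of its
   elements in increasing order. A k x N matrix is a matrix with size N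
   columns, the column t being labelled by the t-th element of N; similarly
   for the rows of an N x p matrix. *)

Definition index_set (N : seq nat) : bool := path ltn 0%N N.

Definition entry (R : realType) (k : nat) (N : seq nat)
    (A : 'M[R]_(k, size N)) (i : 'I_k) (x : nat) : R :=
  oapp (A i) 0 (insub (index x N)).

Definition lrow (R : realType) (p : nat) (N : seq nat)
    (Z : 'M[R]_(size N, p)) (x : nat) : 'rV[R]_p :=
  oapp (fun t => row t Z) 0 (insub (index x N)).

Definition coindependent_at (R : realType) (k : nat) (N : seq nat)
    (J : seq nat) (V : Gr R k (size N)) : Prop :=
  exists A, represents V A /\
    exists I : 'I_k -> 'I_(size N),
      [/\ increasing I, \det (colsub I A) != 0 &
          forall i, nth 0%N N (I i) \notin J].

Definition coindependent (R : realType) (k : nat) (N : seq nat)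
    (J : seq nat) (S : set (Gr R k (size N))) : Prop :=
  forall V, S V -> coindependent_at J V.

(* The condition is empty when m < k + 4. In that case every twistor
   coordinate vanishes at every C *m Z. *)
Definition Mat_pos (R : realType) (m k : nat) : set 'M[R]_(m, k + 4) :=
  [set Z | forall I : 'I_(k + 4) -> 'I_m, increasing I ->
             0 < \det (rowsub I Z)].

Definition tilde (R : realType) (m k : nat) (Z : 'M[R]_(m, k + 4))
    (S : set (Gr R k m)) : set (Gr R k (k + 4)) :=
  [set Y | exists V C, [/\ S V, represents V C & represents Y (C *m Z)]].

Definition Zimage (R : realType) (m k : nat) (Z : 'M[R]_(m, k + 4))
    (S : set (Gr R k m)) : set (Gr R k (k + 4)) :=
  closure (tilde Z S).

Definition pre_mx (R : realType) (k : nat) (N I : seq nat)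
    (A : 'M[R]_(k, size N)) : 'M[R]_(k, size (sort leq (N ++ I))) :=
  \matrix_(i, t) entry A i (nth 0%N (sort leq (N ++ I)) t).

Definition cyc_mx (R : realType) (k m : nat) (A : 'M[R]_(k, m)) : 'M[R]_(k, m) :=
  \matrix_(i, t) ((if t == 0%N :> nat then (-1) ^+ k.-1 else 1) * A i (ord_pred t)).

Definition refl_mx (R : realType) (k m : nat) (A : 'M[R]_(k, m)) : 'M[R]_(k, m) :=
  \matrix_(i, t) ((if i == 0%N :> nat then (-1) ^+ 'C(k, 2) else 1) * A i (rev_ord t)).

Definition image_by (R : realType) (k m m' : nat)
    (f : 'M[R]_(k, m) -> 'M[R]_(k, m')) (S : set (Gr R k m)) : set (Gr R k m') :=
  [set W | exists V A, [/\ S V, represents V A & represents W (f A)]].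

Definition pre (R : realType) (k : nat) (N I : seq nat) :=
  image_by (@pre_mx R k N I).
Arguments pre {R k N} I _.

Definition cyc (R : realType) (k m : nat) := image_by (@cyc_mx R k m).

Definition refl (R : realType) (k m : nat) := image_by (@refl_mx R k m).

(* Polynomials with real coefficients in the formal variables <<i1 i2 i3 i4>>. *)

Notation twidx := (4.-tuple nat).
Notation monomial := (cmonom twidx).
Notation twpoly R := (malg monomial R).

Definition monom_val (S : comNzRingType) (v : twidx -> S) (m : monomial) : S :=
  \prod_(I <- finsupp m) v I ^+ m I.

Definition twvar (R : realType) (I : twidx) : twpoly R :=
  mkmalgU (ucm I : monomial) 1.

Definition tweval (R : realType) (v : twidx -> R) (P : twpoly R) : R :=
  mmap idfun (monom_val v) P.

Definition rename (R : realType) (s : twidx -> twidx) (P : twpoly R) : twpoly R :=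
  mmap (fun c : R => mkmalgU (onecm twidx : monomial) c : twpoly R)
    (monom_val (fun I => twvar R (s I))) P.

Definition index_deg (x : nat) (m : monomial) : nat :=
  (\sum_(I <- finsupp m) m I * count_mem x I)%N.

Definition functionary (R : realType) (N : seq nat) (P : twpoly R) : Prop :=
  (forall m, m \in msupp P -> forall I : twidx, I \in finsupp m ->
     sorted ltn I && all (mem N) I) /\
  (exists e : nat, forall m, m \in msupp P -> mdeg m = e).

Definition pure (R : realType) (P : twpoly R) : Prop :=
  forall m m', m \in msupp P -> m' \in msupp P ->
  forall x, index_deg x m = index_deg x m'.

Definition occurs (R : realType) (x : nat) (P : twpoly R) : Prop :=
  exists2 m, m \in msupp P & (0 < index_deg x m)%N.

Definition cyc_star (R : realType) (N : seq nat) : twpoly R -> twpoly R :=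
  rename (fun I => [tuple of sort leq (map (next N) I)]).

Definition refl_star (R : realType) (N : seq nat) : twpoly R -> twpoly R :=
  rename (fun I => [tuple of sort leq
                      (map (fun x => nth 0%N (rev N) (index x N)) I)]).

(* A is a representative of Y, and z lists the rows Z_i. *)
Definition twistor (R : realType) (k : nat) (A : 'M[R]_(k, k + 4))
    (z : nat -> 'rV[R]_(k + 4)) (I : twidx) : R :=
  \det (col_mx A (\matrix_(r < 4) z (tnth I r))).

(* A rational function, given on the representatives A of the points by its
   domain (the denominators are nonzero) and its value, vanishes on X if it is
   defined on a dense subset of X and is zero wherever it is defined on X. *)
Definition vanishes_on (R : realType) (k n : nat) (X : set (Gr R k n))
    (dom : 'M[R]_(k, n) -> Prop) (f : 'M[R]_(k, n) -> R) : Prop :=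
  X `<=` closure (X `&` [set Y | exists2 A, represents Y A & dom A]) /\
  (forall Y A, X Y -> represents Y A -> dom A -> f A = 0).

Definition fvanishes (R : realType) (k : nat) (N : seq nat)
    (Z : 'M[R]_(size N, k + 4)) (S : set (Gr R k (size N))) (P : twpoly R) : Prop :=
  vanishes_on (Zimage Z S) (fun _ => True)
    (fun A => tweval (twistor A (lrow Z)) P).

(* The rational functionary P / Q. *)
Definition rvanishes (R : realType) (k : nat) (N : seq nat)
    (Z : 'M[R]_(size N, k + 4)) (S : set (Gr R k (size N)))
    (P Q : twpoly R) : Prop :=
  vanishes_on (Zimage Z S)
    (fun A => tweval (twistor A (lrow Z)) Q != 0)
    (fun A => tweval (twistor A (lrow Z)) P / tweval (twistor A (lrow Z)) Q).

Definition consecutive (N : seq nat) (x y : nat) : Prop :=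
  [/\ x \in N, y \in N, (x < y)%N & forall z, z \in N -> ~~ (x < z < y)%N].

Definition bcfw_indices (N : seq nat) (a b c d n : nat) : Prop :=
  [/\ n \in N /\ (forall x, x \in N -> (x <= n)%N), consecutive N a b,
      (b < c)%N, consecutive N c d & consecutive N d n].

Definition N_left (N : seq nat) (a b n : nat) : seq nat :=
  [seq x <- N | [|| (x <= a)%N, x == b | x == n]].

Definition N_right (N : seq nat) (b d n : nat) : seq nat :=
  [seq x <- N | (b <= x <= d)%N || (x == n)].

Definition bcfw_mx (R : realType) (N : seq nat) (a b c d n kL kR : nat)
    (A : 'M[R]_(kL, size (N_left N a b n)))
    (al be ga de ep : R)
    (B : 'M[R]_(kR, size (N_right N b d n))) : 'M[R]_(kL + 1 + kR, size N) :=
  col_mx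
    (col_mx
      (\matrix_(i < kL, t < size N)
         let x := nth 0%N N t in
         if (x < a)%N then entry A i x
         else if x == a then entry A i a + al / be * entry A i b
         else if x == b then entry A i b
         else if x == n then (-1) ^+ kR.+1 * entry A i n
         else 0)
      (\matrix_(i < 1, t < size N)
         let x := nth 0%N N t in
         if x == a then al
         else if x == b then be
         else if x == c then (-1) ^+ kR * ga
         else if x == d then (-1) ^+ kR * de
         else if x == n then (-1) ^+ kR * ep
         else 0))
    (\matrix_(i < kR, t < size N)
       let x := nth 0%N N t in
       if (x < b)%N then 0
       else if (x < c)%N then entry B i x
       else if x == c then
         entry B i c + ga / de * (entry B i d + de / ep * entry B i n)
       else if x == d then entry B i d + de / ep * entry B i n
       else entry B i n).

(* A point of Gr^{>0}_{1,5} is [al : be : ga : de : ep] with positive entries. *)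
Definition bcfw_product (R : realType) (N : seq nat) (a b c d n kL kR : nat)
    (SL : set (Gr R kL (size (N_left N a b n))))
    (SR : set (Gr R kR (size (N_right N b d n)))) :
    set (Gr R (kL + 1 + kR) (size N)) :=
  [set W | exists VL A VR B al be ga de ep,
     [/\ SL VL /\ represents VL A, SR VR /\ represents VR B,
         [/\ 0 < al, 0 < be, 0 < ga, 0 < de & 0 < ep] &
         represents W (bcfw_mx c A al be ga de ep B)]].

(* Product promotion: the twistor coordinates are evaluated at the substituted
   rows, and each denominator is required to be nonzero only if the
   corresponding substitution acts on F. *)

Definition subst_left (R : realType) (k : nat) (a b c d n : nat)
    (A : 'M[R]_(k, k + 4)) (z : nat -> 'rV[R]_(k + 4)) : nat -> 'rV[R]_(k + 4) :=
  let tw i j l m := twistor A z [tuple i; j; l; m] in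
  fun x =>
    if x == b then z b - (tw b c d n / tw a c d n) *: z a
    else z x.

Definition subst_right (R : realType) (k : nat) (a b c d n : nat)
    (A : 'M[R]_(k, k + 4)) (z : nat -> 'rV[R]_(k + 4)) : nat -> 'rV[R]_(k + 4) :=
  let tw i j l m := twistor A z [tuple i; j; l; m] in
  fun x =>
    if x == n then z n - (tw a b c n / tw a b c d) *: z d
                       + (tw a b d n / tw a b c d) *: z c
    else if x == d then z d - (tw a b d n / tw a b c n) *: z c
    else z x.

Definition psi_left_vanishes (R : realType) (k : nat) (N : seq nat)
    (a b c d n : nat) (Z : 'M[R]_(size N, k + 4)) (S : set (Gr R k (size N)))
    (F : twpoly R) : Prop :=
  vanishes_on (Zimage Z S)
    (fun A => occurs b F -> twistor A (lrow Z) [tuple a; c; d; n] != 0)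
    (fun A => tweval (twistor A (subst_left a b c d n A (lrow Z))) F).

Definition psi_right_vanishes (R : realType) (k : nat) (N : seq nat)
    (a b c d n : nat) (Z : 'M[R]_(size N, k + 4)) (S : set (Gr R k (size N)))
    (F : twpoly R) : Prop :=
  vanishes_on (Zimage Z S)
    (fun A => (occurs n F -> twistor A (lrow Z) [tuple a; b; c; d] != 0) /\
              (occurs d F -> twistor A (lrow Z) [tuple a; b; c; n] != 0))
    (fun A => tweval (twistor A (subst_right a b c d n A (lrow Z))) F).

(* Main.v *)
Require Import Defs.
From HB Require Import structures.
From mathcomp Require Import all_boot all_order all_algebra all_fingroup finmap.
From mathcomp Require Import all_classical all_reals topology normedtype.
From mathcomp Require Import zify.

(* The quotient map onto the Grassmannian is open, so closures and vanishing can
   be tested on representing matrices.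

   Part (1): each of pre, cyc, refl multiplies the representatives of S by a
   constant matrix, which can be moved to Z. The modified Z is again positive
   (for refl after a change of basis of the ambient space R^(k+4)), and the
   twistor coordinates change only by signs depending on the number of
   occurrences of one index, which purity turns into a global sign.

   Part (2): let Y be the image of a BCFW matrix. Its middle row puts
   al Z_a + be Z_b +- ga Z_c +- de Z_d +- ep Z_n into Y, which evaluates the
   ratios of twistor coordinates in the promotion: they are al / be, ga / de
   and de / ep up to sign. The substituted vectors are then exactly the ones for
   which the first kL (resp. last kR) rows of Y read A * Z' (resp. B * Z'), so
   modulo the other rows the promoted twistor coordinates of Y are, up to signs
   and a common factor, the twistor coordinates of the left (resp. right)
   factor at some Z' that need not be positive. Positive matrices are Zariski
   dense, so F vanishes there too. The denominators do not vanish on the image: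
   modulo row operations <<acdn>> is a determinant whose Cauchy-Binet expansion
   has terms (minor of A) * (minor of B) * (maximal minor of Z), all nonnegative
   and, by coindependence, not all zero. *)

Set Implicit Arguments.
Unset Strict Implicit.
Unset Printing Implicit Defensive.

Import Order.TTheory GRing.Theory Num.Theory.
Import numFieldNormedType.Exports.

Local Open Scope classical_set_scope.
Local Open Scope ring_scope.

(** * Limits of matrices and determinants *)

Section MatrixLimits.
Context {R : realType} {T : Type} {F : set_system T} {FF : Filter F}.

Lemma cvg_mx m n (f : T -> 'M[R]_(m, n)) (M : 'M[R]_(m, n)) :
  (forall i j, f x i j @[x --> F] --> M i j) -> f @ F --> M.
Proof.
move=> fM U [P MP PU]; apply: (@filterS _ _ _ [set x | forall i j, P i j (f x i j)]).
  by move=> x; apply: PU.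
by apply: filter_forall => i; apply: filter_forall => j; apply: fM; apply: MP.
Qed.

Lemma cvg_entry m n (f : T -> 'M[R]_(m, n)) (M : 'M[R]_(m, n)) i j :
  f @ F --> M -> f x i j @[x --> F] --> M i j.
Proof.
move=> fM.
exact: (@cvg_comp _ _ _ f (fun N : 'M[R]_(m, n) => N i j) _ _ _ fM
  (@coord_continuous R m n i j M)).
Qed.

Lemma cvg_sumr (I : Type) (r : seq I) (P : pred I) (f : I -> T -> R) (a : I -> R) :
  (forall i, P i -> f i x @[x --> F] --> a i) ->
  \sum_(i <- r | P i) f i x @[x --> F] --> \sum_(i <- r | P i) a i.
Proof.
move=> fa; elim: r => [|i r IHr].
  under eq_fun do rewrite big_nil.
  by rewrite big_nil; apply: cvg_cst.
under eq_fun do rewrite big_cons.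
by rewrite big_cons; case: ifP => // Pi; apply: cvgD => //; apply: fa.
Qed.

Lemma cvg_prodr (I : Type) (r : seq I) (P : pred I) (f : I -> T -> R) (a : I -> R) :
  (forall i, P i -> f i x @[x --> F] --> a i) ->
  \prod_(i <- r | P i) f i x @[x --> F] --> \prod_(i <- r | P i) a i.
Proof.
move=> fa; elim: r => [|i r IHr].
  under eq_fun do rewrite big_nil.
  by rewrite big_nil; apply: cvg_cst.
under eq_fun do rewrite big_cons.
by rewrite big_cons; case: ifP => // Pi; apply: cvgM => //; apply: fa.
Qed.

Lemma cvg_det n (f : T -> 'M[R]_n) (A : 'M[R]_n) :
  f @ F --> A -> \det (f x) @[x --> F] --> \det A.
Proof.
move=> fA; apply: cvg_sumr => s _; apply: cvgM; first exact: cvg_cst.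
by apply: cvg_prodr => i _; apply: cvg_entry.
Qed.

Lemma cvg_col_mx m1 m2 n (f : T -> 'M[R]_(m1, n)) (g : T -> 'M[R]_(m2, n))
    (A : 'M[R]_(m1, n)) (B : 'M[R]_(m2, n)) :
  f @ F --> A -> g @ F --> B -> col_mx (f x) (g x) @[x --> F] --> col_mx A B.
Proof.
move=> fA gB; apply: cvg_mx => i j; rewrite mxE.
under eq_fun do rewrite mxE.
by case: fintype.split => l; apply: cvg_entry.
Qed.

End MatrixLimits.

(** * Representatives and the quotient topology of the Grassmannian *)

Section GrTopology.
Context {R : realType} {k n : nat}.
Implicit Types (A B : 'M[R]_(k, n)) (Y : Gr R k n).

Lemma represents_row_free Y A : represents Y A -> row_free A.
Proof. by case=> -[B /= BP] <- _; exact: set_mem BP. Qed.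

Lemma row_free_represents A : row_free A -> exists Y, represents Y A.
Proof.
move=> Afree; pose X : frmx R k n := exist _ A (mem_set Afree).
by exists (\pi_(quotient_topology {eq_quot (@same_span R k n)})%qT X); exists X.
Qed.

Lemma pi_same_spanE (X X' : frmx R k n) :
  (\pi_(quotient_topology {eq_quot (@same_span R k n)})%qT X =
   \pi_(quotient_topology {eq_quot (@same_span R k n)})%qT X') <-> same_span X X'.
Proof.
split; first by move/(@eqquotP _ _ {eq_quot (@same_span R k n)}%qT X X').
by move=> e; apply/(@eqquotP _ _ {eq_quot (@same_span R k n)}%qT X X').
Qed.

Lemma represents_eq Y A B :
  represents Y A -> represents Y B -> exists2 g, g \in unitmx & B = g *m A.
Proof.
move=> [X <- <-] [X' <- /pi_same_spanE XX'].
exact/eqmxMunitP.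
Qed.

Lemma row_free_unitMl A (g : 'M_k) : g \in unitmx -> row_free A -> row_free (g *m A).
Proof. by move=> gu Afree; rewrite /row_free mxrankMfree ?mxrank_unit. Qed.

Lemma represents_mul Y A (g : 'M_k) :
  g \in unitmx -> represents Y A -> represents Y (g *m A).
Proof.
move=> gu YA; have gAfree := row_free_unitMl gu (represents_row_free YA).
case: YA => X XA <-; exists (exist _ (g *m A) (mem_set gAfree)) => //.
apply/pi_same_spanE; rewrite /same_span XA /=.
by apply/eqmxMunitP; exists g.
Qed.

Lemma Gr_represents Y : exists A, represents Y A.
Proof.
by exists (set_val (generic_quotient.repr Y)), (generic_quotient.repr Y) => //; apply: reprK.
Qed.

Definition reps (T : set (Gr R k n)) : set 'M[R]_(k, n) :=
  [set A | exists2 Y, T Y & represents Y A].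

Lemma mulmxl_continuous (g : 'M[R]_k) : continuous (mulmx g : 'M[R]_(k, n) -> _).
Proof.
move=> A; apply: (@cvg_mx R _ (nbhs A) (nbhs_filter A)) => i j; rewrite mxE.
under eq_fun do rewrite mxE.
by apply: cvg_sumr => l _; apply: cvgM; [exact: cvg_cst|exact: coord_continuous].
Qed.

(* The quotient map onto the Grassmannian is open, since its fibres are the
   orbits of a group acting by homeomorphisms. *)
Lemma closure_Gr (T : set (Gr R k n)) Y A :
  represents Y A -> closure T Y <-> closure (reps T) A.
Proof.
move=> YA; split=> [clY U AU|clA U].
  pose O := [set Y' : Gr R k n | exists2 A', U° A' & represents Y' A'].
  have oO : open O.
    rewrite /open /= /quotient_open.
    (* The preimage of [O] under the quotient map is the union of the translates of [U°] by
       invertible matrices. [V] is this union taken among all matrices, hence open. *)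
    pose V := \bigcup_(g in [set g : 'M[R]_k | g \in unitmx]) (mulmx g @^-1` U°) : set 'M[R]_(k, n).
    exists V.
      apply: bigcup_open => g _; apply: open_comp; last exact: open_interior.
      by move=> B _; apply: mulmxl_continuous.
    apply/seteqP; split=> X.
      move=> [g gu gX]; exists (g *m set_val X) => //.
      by apply: represents_mul => //; exists X.
    move=> [A' UA' rA']; have [g gu A'E] := represents_eq (ex_intro2 _ _ X erefl erefl) rA'.
    by exists g => //=; rewrite -A'E.
  have [|Y' [TY' [A' UA' rY']]] := clY O.
    by apply: open_nbhs_nbhs; split=> //; exists A.
  exists A'; split; last exact: interior_subset.
  by exists Y'.
rewrite nbhsE => -[O [oO OY] OU].
move: oO; rewrite /open /= /quotient_open => -[W oW WO].
case: YA => X XA XY.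
have WA : W A.
  rewrite -XA; have : (set_val @^-1` W) X by rewrite WO /= XY.
  by [].
have [A' [[Y' TY' [X' XA' XY']] WA']] := clA W (open_nbhs_nbhs (conj oW WA)).
exists Y'; split => //; apply: OU.
have : (set_val @^-1` W) X' by rewrite /= XA'.
by rewrite WO /= XY'.
Qed.

(** Points of [T] lie in the domain, so the domain is dense in the closure. A nonzero value at a
    point of the closure would persist near its representative, and every such neighbourhood meets
    [reps T], where [f] is zero. *)
Lemma vanishes_on_closure (T : set (Gr R k n)) (dom : 'M[R]_(k, n) -> Prop)
    (f : 'M[R]_(k, n) -> R) :
  (forall A, reps T A -> dom A /\ f A = 0) ->
  (forall A, dom A -> f A != 0 -> \forall A' \near A, f A' != 0) ->
  vanishes_on (closure T) dom f.
Proof.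
move=> Tf f_open; split.
  apply: closureS => Y TY; split; first exact: subset_closure.
  by have [A YA] := Gr_represents Y; exists A => //; apply: (Tf A _).1; exists Y.
move=> Y A cY YA domA; apply/eqP; apply/negPn/negP => fA.
have /(_ _ (f_open _ domA fA)) := ((closure_Gr T YA).1 cY).
by move=> [A' [/Tf[_ ->]]] /=; rewrite eqxx.
Qed.
End GrTopology.

(** * Determinants, Cauchy-Binet and positivity *)

Section Determinants.
Context {R : realType}.

(* Up to a constant, a maximal minor with some rows fixed is a determinant on
   the quotient by the span of the fixed rows. *)
Lemma det_fixed_rows n p q (P : 'M[R]_(n, p + q)) (Q : 'M[R]_(q, n)) :
  n = (p + q)%N -> exists c (T : 'M[R]_(n, p)),
    forall U : 'M[R]_(p, n), \det (P *m col_mx U Q) = c * \det (U *m T).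
Proof.
move=> e; subst n.
(* If [Q] cannot be completed to an invertible matrix, all these determinants are zero and [c = 0]
   works. Otherwise [T] consists of the first [p] columns of the inverse of one completion. *)
have [[U0 U0Q]|QN] := pselect (exists U0, \det (col_mx U0 Q) != 0); last first.
  exists 0, 0 => U; rewrite mul0r det_mulmx; apply/eqP; rewrite mulf_eq0.
  by apply/orP; right; apply/negPn/negP => UQ; apply: QN; exists U.
set G := invmx (col_mx U0 Q).
have GE : col_mx U0 Q *m G = 1%:M by rewrite mulmxV // unitmxE unitfE.
exists (\det P * \det (col_mx U0 Q)), (lsubmx G) => U.
have QG : Q *m G = row_mx 0 1%:M.
  move: GE; rewrite mul_col_mx scalar_mx_block.
  by move/(congr1 dsubmx); rewrite /block_mx !col_mxKd.
have: \det (col_mx U Q *m G) = \det (U *m lsubmx G).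
  rewrite mul_col_mx QG -[U *m G]hsubmxK -/(block_mx _ _ _ _) det_ublock det1 mulr1.
  by rewrite -mulmx_lsub.
rewrite !det_mulmx => <-; rewrite det_inv -!mulrA; congr (_ * _).
by rewrite mulrCA mulfV // mulr1.
Qed.

Lemma det_mul_expand m p (A : 'M[R]_(p, m)) (B : 'M[R]_(m, p)) :
  \det (A *m B) = \sum_(f : {ffun 'I_p -> 'I_m}) (\prod_i A i (f i)) * \det (rowsub f B).
Proof.
rewrite {1}/determinant.
under eq_bigr => s _.
  under eq_bigr => i _ do rewrite mxE.
  rewrite bigA_distr_bigA /= mulr_sumr.
  over.
rewrite exchange_big /=; apply: eq_bigr => f _.
rewrite mulr_sumr; apply: eq_bigr => s _.
rewrite big_split /= mulrCA; congr (_ * (_ * _)).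
by apply: eq_bigr => i _; rewrite mxE.
Qed.

(* Cauchy-Binet, with the sum over all maps instead of the increasing ones. *)
Lemma cauchy_binet m p (A : 'M[R]_(p, m)) (B : 'M[R]_(m, p)) :
  (p`!)%:R * \det (A *m B) =
  \sum_(f : {ffun 'I_p -> 'I_m}) \det (colsub f A) * \det (rowsub f B).
Proof.
have -> : (p`!)%:R * \det (A *m B) = \sum_(s : 'S_p) \det (A *m B).
  by rewrite sumr_const card_Sn mulr_natl.
(* The p! equal terms are expanded with the rows of [A] permuted by [s]; for fixed [f] the sum over
   [s] is then the Leibniz formula of the minor of [A]. *)
under eq_bigr => s _.
  have -> : \det (A *m B) = (-1) ^+ s * \det (row_perm s A *m B).
    rewrite row_permE -mulmxA det_mulmx det_perm.
    by rewrite mulrA -signr_addb addbb expr0 mul1r.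
  rewrite det_mul_expand mulr_sumr; over.
rewrite exchange_big /=; apply: eq_bigr => f _.
rewrite -[\det (colsub f A)]det_tr {2}/determinant mulr_suml; apply: eq_bigr => s _.
rewrite -mulrA; congr (_ * (_ * _)).
apply: eq_bigr => i _.
by rewrite !mxE.
Qed.

Lemma rowsub_det0 m p (f : 'I_p -> 'I_m) (B : 'M[R]_(m, p)) :
  ~ injective f -> \det (rowsub f B) = 0.
Proof.
move=> finj; suff [i [j [ij fij]]] : exists i j, i != j /\ f i = f j.
  by apply: (determinant_alternate ij) => l; rewrite !mxE fij.
apply: contrapT => H; apply: finj => i j fij; apply/eqP/negPn/negP => ij.
by apply: H; exists i, j.
Qed.

Lemma increasing_perm m p (f : 'I_p -> 'I_m) :
  injective f -> exists s : 'S_p, increasing (f \o s).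
Proof.
move=> finj; pose t := [tuple f i | i < p].
have tE : val t = [seq f i | i <- enum 'I_p] by [].
have ut : uniq t by rewrite tE map_inj_uniq ?enum_uniq.
pose r := relpre (@nat_of_ord m) leq.
have rtot : total r by move=> x y; apply: leq_total.
have rtr : transitive r by move=> x y z; apply: leq_trans.
have /tuple_permP[s sE] : perm_eq (sort r t) t by rewrite perm_sort.
have ss : sorted r (sort r t) by exact: sort_sorted.
exists s => i j ij /=.
have nthE (l : 'I_p) : nth (f i) (sort r t) l = f (s l).
  by rewrite sE -tnth_nth !tnth_mktuple.
have szs : size (sort r t) = p by rewrite size_sort size_tuple.
have := @sorted_leq_nth _ r rtr (fun x => leqnn x) (f i) _ ss i j.
rewrite !inE szs !ltn_ord => /(_ isT isT (ltnW ij)).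
rewrite !nthE /r /= leq_eqVlt => /orP[/eqP e|//].
by move/val_inj/finj/perm_inj: e => e; rewrite e ltnn in ij.
Qed.

(** In the Cauchy-Binet sum a non-injective map contributes zero. Sorting an injective map changes
    both minors by the same sign, so its term equals that of an increasing map and is nonnegative;
    the term of [f0] is positive. *)
Lemma det_mul_gt0 m p c (A : 'M[R]_(p, m)) (B : 'M[R]_(m, p)) :
  (forall f, increasing f -> 0 <= \det (colsub f A)) ->
  (exists2 f, increasing f & \det (colsub f A) != 0) ->
  (forall f, increasing f -> \det (colsub f A) != 0 -> 0 < c * \det (rowsub f B)) ->
  0 < c * \det (A *m B).
Proof.
move=> A0 [f0 f0i Af0] cB.
have p0 : 0 < (p`!)%:R :> R by rewrite ltr0n fact_gt0.
rewrite -(pmulr_rgt0 _ p0) mulrCA cauchy_binet mulr_sumr.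
have incr_ge0 (f : 'I_p -> 'I_m) : increasing f ->
    0 <= c * (\det (colsub f A) * \det (rowsub f B)).
  move=> fi; have := A0 _ fi; rewrite le_eqVlt => /orP[/eqP <-|fA].
    by rewrite mul0r mulr0.
  by rewrite mulrCA; apply: mulr_ge0; [exact: ltW|apply/ltW/cB => //; rewrite gt_eqF].
rewrite (bigD1 (finfun f0)) //=; apply: ltr_wpDr; last first.
  have /eq_colsub -> : finfun f0 =1 f0 by move=> i; rewrite ffunE.
  have /eq_rowsub -> : finfun f0 =1 f0 by move=> i; rewrite ffunE.
  by rewrite mulrCA; apply: mulr_gt0; [rewrite lt0r Af0 A0|apply: cB].
apply: sumr_ge0 => f _.
have [finj|/rowsub_det0 ->] := pselect (injective f); last by rewrite !mulr0.
have [s fsi] := increasing_perm finj.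
have := incr_ge0 _ fsi.
have -> : colsub (f \o s) A = col_perm s (colsub f A) by apply/matrixP => i j; rewrite !mxE.
have -> : rowsub (f \o s) B = row_perm s (rowsub f B) by apply/matrixP => i j; rewrite !mxE.
rewrite col_permE row_permE !det_mulmx !det_perm odd_permV [_ * (-1) ^+ _]mulrC mulrACA.
by rewrite -signr_addb addbb expr0 mul1r.
Qed.

(* [D] stands for the determinant as a function of some of its rows. *)
Lemma det_rows_gt0 m n p (D : 'M[R]_(p, n) -> R) (A : 'M[R]_(p, m)) (Z : 'M[R]_(m, n)) :
  (exists c (T : 'M[R]_(n, p)), forall U, D U = c * \det (U *m T)) ->
  (forall f, increasing f -> 0 <= \det (colsub f A)) ->
  (exists2 f, increasing f & \det (colsub f A) != 0) ->
  (forall f, increasing f -> \det (colsub f A) != 0 -> 0 < D (rowsub f Z)) ->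
  0 < D (A *m Z).
Proof.
move=> [c [T DE]] A0 A1 DZ; rewrite DE -mulmxA; apply: det_mul_gt0 => // f fi fA.
by rewrite -mul_rowsub_mx -DE; apply: DZ.
Qed.

(** Moving the top row below the [n] others costs [(-1) ^+ n]; both determinants are expanded along
    the moved row. *)
Lemma det_rowshift n c (A B : 'M[R]_n.+1) :
  row ord_max B = c *: row 0 A ->
  (forall i : 'I_n, row (lift ord_max i) B = row (lift 0 i) A) ->
  \det B = c * (-1) ^+ n * \det A.
Proof.
move=> B0 BS; rewrite (expand_det_row B ord_max) (expand_det_row A 0) mulr_sumr.
apply: eq_bigr => j _; rewrite /cofactor.
have -> : B ord_max j = c * A 0 j by have /rowP/(_ j) := B0; rewrite !mxE.
have -> : row' ord_max (col' j B) = row' 0 (col' j A).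
  by apply/matrixP => i l; have /rowP/(_ (lift j l)) := BS i; rewrite !mxE.
by rewrite add0n exprD -!mulrA; congr (_ * _); rewrite mulrCA.
Qed.

Definition fcat m p q (f : 'I_p -> 'I_m) (g : 'I_q -> 'I_m) (i : 'I_(p + q)) : 'I_m :=
  match fintype.split i with inl j => f j | inr j => g j end.

Lemma increasing_fcat m p q (f : 'I_p -> 'I_m) (g : 'I_q -> 'I_m) :
  increasing f -> increasing g -> (forall i j, f i < g j)%N -> increasing (fcat f g).
Proof.
move=> fi gi fg i j; rewrite /fcat.
case: splitP => i' ->; case: splitP => j' ->; first exact: fi.
- by move=> _; apply: fg.
- by move=> ltij; have := ltn_trans ltij (ltn_ord j'); rewrite ltnNge leq_addr.
- by rewrite ltn_add2l; apply: gi.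
Qed.

Lemma rowsub_fcat m n p q (f : 'I_p -> 'I_m) (g : 'I_q -> 'I_m) (Z : 'M[R]_(m, n)) :
  rowsub (fcat f g) Z = col_mx (rowsub f Z) (rowsub g Z).
Proof.
apply/matrixP => i j; rewrite !mxE /fcat.
by case: fintype.split => l; rewrite mxE.
Qed.

Lemma det_eq0_row_free n (A : 'M[R]_n) : (\det A != 0) = row_free A.
Proof. by rewrite row_free_unit unitmxE unitfE. Qed.

(** The rows (1, i, i^2, ...) have Vandermonde minors, which are products of differences of
    increasing nodes. *)
Lemma Mat_pos_nonempty m k : exists Z : 'M[R]_(m, k + 4), Mat_pos Z.
Proof.
exists (\matrix_(i, j) (i%:R ^+ j)) => I Iincr.
have -> : rowsub I (\matrix_(i < m, j < k + 4) (i%:R ^+ j)) =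
    (Vandermonde (k + 4) (\row_j ((I j)%:R : R)))^T.
  by apply/matrixP => i j; rewrite !mxE.
rewrite det_tr det_Vandermonde; apply: prodr_gt0 => i _; apply: prodr_gt0 => j ij.
by rewrite !mxE subr_gt0 ltr_nat Iincr.
Qed.
End Determinants.

(** * Evaluation of functionaries *)

Section FunctionaryEvaluation.
Context {R : realType}.
Implicit Types (v w : twidx -> R) (P : twpoly R) (m : monomial).

Lemma monom_valEw (S : comNzRingType) (u : twidx -> S) m (d : {fset twidx}) :
  (finsupp m `<=` d)%fset -> monom_val u m = \prod_(I <- d) u I ^+ m I.
Proof.
move=> md; rewrite /monom_val (big_fset_incl _ md) // => I _.
by rewrite -cmE_neq0 negbK => /eqP ->; rewrite expr0.
Qed.

(** Multiplicativity on monomials makes evaluation and renaming, both instances of [mmap], ring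
    morphisms. *)
Lemma monom_val_mmorphism (S : comNzRingType) (u : twidx -> S) :
  mmorphism (monom_val u).
Proof.
split=> [m1 m2|]; last by rewrite /monom_val mdom1 big_seq_fset0.
rewrite {1}/monom_val mdomD.
rewrite (monom_valEw u (fsubsetUl _ (finsupp m2))) (monom_valEw u (fsubsetUr (finsupp m1) _)).
by rewrite -big_split /=; apply: eq_bigr => I _; rewrite cmM exprD.
Qed.

HB.instance Definition _ (S : comNzRingType) (u : twidx -> S) :=
  monalg.isMultiplicative.Build _ S (monom_val u) (monom_val_mmorphism u).

Lemma twevalM v : {morph tweval v : P Q / P * Q}.
Proof. by move=> P Q; rewrite /tweval rmorphM. Qed.

Lemma tweval_sum v (I : Type) (r : seq I) (F : I -> twpoly R) :
  tweval v (\sum_(i <- r) F i) = \sum_(i <- r) tweval v (F i).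
Proof. by rewrite /tweval raddf_sum. Qed.

Lemma tweval_monom_val v (u : twidx -> twpoly R) m :
  tweval v (monom_val u m) = monom_val (fun I => tweval v (u I)) m.
Proof.
rewrite /tweval [monom_val u m]/monom_val rmorph_prod; apply: eq_bigr => I _.
by rewrite rmorphXn.
Qed.

Lemma tweval_var v I : tweval v (twvar R I) = v I.
Proof.
by rewrite /tweval /twvar mmapU /= mul1r /monom_val mdomU big_seq_fset1 cmUU expr1.
Qed.

Lemma tweval_rename v (s : twidx -> twidx) P :
  tweval v (rename s P) = tweval (v \o s) P.
Proof.
rewrite /rename mmapE tweval_sum /tweval; apply: eq_bigr => m _.
rewrite -/(tweval v _) twevalM tweval_monom_val; congr (_ * _).
  by rewrite /tweval mmapU /= mmorph1 mulr1.
by apply: eq_bigr => I _; rewrite tweval_var.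
Qed.

Lemma eq_tweval v w P :
  (forall m, m \in msupp P -> forall I, I \in finsupp m -> v I = w I) ->
  tweval v P = tweval w P.
Proof.
move=> vw; rewrite /tweval !mmapE [LHS]big_seq [RHS]big_seq.
apply: eq_bigr => m mP; congr (_ * _).
by rewrite /monom_val big_seq [RHS]big_seq; apply: eq_bigr => I Im; rewrite (vw m).
Qed.

Lemma eq_in_tweval N v w P : functionary N P ->
  (forall I : twidx, sorted ltn I -> all (mem N) I -> v I = w I) ->
  tweval v P = tweval w P.
Proof.
by move=> [NP _] vw; apply: eq_tweval => m mP I Im; have /andP[] := NP m mP I Im; exact: vw.
Qed.

(** Every monomial of [P] has the same degree [e] and, by purity, contains the index [x] the same
    number [f] of times, so the factors of the single coordinates combine to one global factor.
    Since [e] and [f] depend only on [P] and [x], this factor is uniform in the evaluation point. *)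
Lemma tweval_scale N P x : functionary N P -> pure P ->
  exists e f : nat, forall v w (c s : R),
    (forall I : twidx, sorted ltn I -> all (mem N) I ->
       v I = c * s ^+ count_mem x I * w I) ->
    tweval v P = c ^+ e * s ^+ f * tweval w P.
Proof.
move=> [NP [e eP]] pP.
(* The zero polynomial has no monomial from which to read off [f]; any value serves. *)
have [f fP] : exists f, forall m, m \in msupp P -> index_deg x m = f.
  have [[m0 m0P]|NP0] := pselect (exists m0, m0 \in msupp P).
    by exists (index_deg x m0) => m mP; apply: pP.
  by exists 0%N => m mP; case: NP0; exists m.
exists e, f => v w c s vw; rewrite /tweval !mmapE mulr_sumr [LHS]big_seq [RHS]big_seq.
apply: eq_bigr => m mP; rewrite [RHS]mulrCA; congr (_ * _).
rewrite -(eP _ mP) -(fP _ mP) /monom_val /mdeg /index_deg !expr_sum -!big_split /=.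
rewrite big_seq [RHS]big_seq; apply: eq_bigr => I Im.
have /andP[Is IN] := NP m mP I Im.
by rewrite vw // !exprMn exprM exprAC.
Qed.
End FunctionaryEvaluation.

(** * Symmetry and linearity of twistor coordinates *)

Section Twistors.
Context {R : realType} {k : nat}.
Implicit Types (A : 'M[R]_(k, k + 4)) (z : nat -> 'rV[R]_(k + 4)) (I : twidx).

Lemma eq_twistor A z z' I : {in I, z =1 z'} -> twistor A z I = twistor A z' I.
Proof.
move=> zz'; congr (\det (col_mx _ _)); apply/row_matrixP => i.
by rewrite !rowK zz' // mem_tnth.
Qed.

Lemma twistor_mull A z I (g : 'M_k) : twistor (g *m A) z I = \det g * twistor A z I.
Proof.
rewrite /twistor; set M := \matrix_r _.
have -> : col_mx (g *m A) M = block_mx g 0 0 1%:M *m col_mx A M.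
  by rewrite mul_block_col !mul0mx mul1mx addr0 add0r.
by rewrite det_mulmx det_ublock det1 mulr1.
Qed.

Lemma twistor_mulr A z I (E : 'M_(k + 4)) :
  twistor (A *m E) (fun x => z x *m E) I = \det E * twistor A z I.
Proof.
rewrite /twistor mulrC -det_mulmx mul_col_mx; congr (\det (col_mx _ _)).
by apply/row_matrixP => i; rewrite row_mul !rowK.
Qed.

Lemma twistor_scale A z I (s : nat -> R) :
  twistor A (fun x => s x *: z x) I = (\prod_(x <- I) s x) * twistor A z I.
Proof.
rewrite /twistor; set M := (\matrix_r z _).
set M' := (\matrix_r _).
have -> : col_mx A M' = block_mx 1%:M 0 0 (diag_mx (\row_r s (tnth I r))) *m col_mx A M.
  rewrite mul_block_col !mul0mx mul1mx addr0 add0r; congr col_mx.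
  by apply/matrixP => i j; rewrite mul_diag_mx !mxE.
rewrite det_mulmx det_ublock det1 mul1r det_diag; congr (_ * _).
by rewrite big_tuple; apply: eq_bigr => i _; rewrite mxE.
Qed.

Lemma twistor_perm A z I (s : 'S_4) :
  twistor A z [tuple tnth I (s i) | i < 4] = (-1) ^+ s * twistor A z I.
Proof.
rewrite /twistor; set M := (\matrix_r z (tnth I r)); set M' := (\matrix_r _).
have -> : col_mx A M' = block_mx 1%:M 0 0 (perm_mx s) *m col_mx A M.
  rewrite mul_block_col !mul0mx mul1mx addr0 add0r; congr col_mx.
  by apply/row_matrixP => i; rewrite -row_permE rowK tnth_mktuple; apply/rowP => j; rewrite !mxE.
by rewrite det_mulmx det_ublock det1 mul1r det_perm.
Qed.

Lemma twistor_swap01 A z (a b c d : nat) :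
  twistor A z [tuple b; a; c; d] = - twistor A z [tuple a; b; c; d].
Proof.
have /(congr1 (twistor A z)) :
    [tuple tnth [tuple a; b; c; d] (tperm ord0 (inord 1) i) | i < 4] =
    [tuple b; a; c; d].
  apply: eq_from_tnth => r; rewrite tnth_mktuple.
  have -> : inord 1 = Ordinal (isT : (1 < 4)%N) by apply/val_inj; rewrite /= inordK.
  by rewrite permE; case: r => [[|[|[|[|r]]]] Hr].
by rewrite twistor_perm odd_tperm -val_eqE /= inordK // expr1 mulN1r => ->.
Qed.

Lemma twistor_swap12 A z (a b c d : nat) :
  twistor A z [tuple a; c; b; d] = - twistor A z [tuple a; b; c; d].
Proof.
have /(congr1 (twistor A z)) :
    [tuple tnth [tuple a; b; c; d] (tperm (inord 1) (inord 2) i) | i < 4] =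
    [tuple a; c; b; d].
  apply: eq_from_tnth => r; rewrite tnth_mktuple.
  have -> : inord 1 = Ordinal (isT : (1 < 4)%N) by apply/val_inj; rewrite /= inordK.
  have -> : inord 2 = Ordinal (isT : (2 < 4)%N) by apply/val_inj; rewrite /= inordK.
  by rewrite permE; case: r => [[|[|[|[|r]]]] Hr].
by rewrite twistor_perm odd_tperm -val_eqE /= !inordK // expr1 mulN1r => ->.
Qed.

Lemma twistor_swap23 A z (a b c d : nat) :
  twistor A z [tuple a; b; d; c] = - twistor A z [tuple a; b; c; d].
Proof.
have /(congr1 (twistor A z)) :
    [tuple tnth [tuple a; b; c; d] (tperm (inord 2) (inord 3) i) | i < 4] =
    [tuple a; b; d; c].
  apply: eq_from_tnth => r; rewrite tnth_mktuple.
  have -> : inord 2 = Ordinal (isT : (2 < 4)%N) by apply/val_inj; rewrite /= inordK.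
  have -> : inord 3 = Ordinal (isT : (3 < 4)%N) by apply/val_inj; rewrite /= inordK.
  by rewrite permE; case: r => [[|[|[|[|r]]]] Hr].
by rewrite twistor_perm odd_tperm -val_eqE /= !inordK // expr1 mulN1r => ->.
Qed.

Lemma twistor_repeat A z (a b c : nat) : twistor A z [tuple a; a; b; c] = 0.
Proof.
have := twistor_swap01 A z a a b c; move/eqP; rewrite -addr_eq0 -mulr2n mulrn_eq0 /=.
by move/eqP.
Qed.

(** [phi] is the vector of cofactors along the row of the first index. It annihilates the rows of
    [A] because putting one of them in that row repeats a row. Linear relations modulo the span of
    [A] thus become relations between twistor coordinates. *)
Lemma twistor_linear A z (x y w : nat) : exists phi : 'cV[R]_(k + 4),
  (forall a, twistor A z [tuple a; x; y; w] = (z a *m phi) 0 0) /\ A *m phi = 0.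
Proof.
(* The entry [0%N] of the tuple is a placeholder for the slot occupied by [u]. *)
pose M u := col_mx A (\matrix_(r < 4) if r == 0 then u else z (tnth [tuple 0%N; x; y; w] r)).
pose i0 : 'I_(k + 4) := rshift k 0.
pose phi : 'cV[R]_(k + 4) := \col_j cofactor (M 0) i0 j.
have detM u : \det (M u) = (u *m phi) 0 0.
  rewrite (expand_det_row _ i0) mxE; apply: eq_bigr => j _; rewrite [phi _ _]mxE.
  congr (_ * _); first by rewrite /M col_mxEd mxE.
  rewrite /cofactor; congr (_ * \det _); apply/matrixP => i l; rewrite !mxE.
  case: splitP => // r rE; rewrite !mxE; case: eqP => // r0; exfalso.
  by have := neq_lift i0 i; rewrite -val_eqE [X in _ != X]rE r0 eqxx.
exists phi; split=> [a|].
  rewrite -detM; congr (\det (col_mx _ _)); apply/row_matrixP => r; rewrite !rowK.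
  by case: r => [[|[|[|[|r]]]] Hr].
apply/colP => i; rewrite [RHS]mxE.
have -> : (A *m phi) i 0 = (row i A *m phi) 0 0 by rewrite -row_mul [RHS]mxE.
rewrite -detM; apply: (determinant_alternate (i1 := lshift 4 i) (i2 := i0)).
  by rewrite eq_lrshift.
by move=> j; rewrite /M col_mxEu col_mxEd !mxE.
Qed.
End Twistors.

(** * Matrices with labelled rows or columns *)

Section LabelledMatrices.
Context {R : realType}.

Lemma index_set_uniq N : index_set N -> uniq N.
Proof.
by move/path_sorted; apply: sorted_uniq => //; [exact: ltn_trans|move=> x; rewrite /= ltnn].
Qed.

Lemma lrow_nth p N (Z : 'M[R]_(size N, p)) (t : 'I_(size N)) :
  uniq N -> lrow Z (nth 0%N N t) = row t Z.
Proof. by move=> uN; rewrite /lrow index_uniq // valK. Qed.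

Lemma entry_nth k N (A : 'M[R]_(k, size N)) i (t : 'I_(size N)) :
  uniq N -> entry A i (nth 0%N N t) = A i t.
Proof. by move=> uN; rewrite /entry index_uniq // valK. Qed.

Lemma entry_out k N (A : 'M[R]_(k, size N)) i x : x \notin N -> entry A i x = 0.
Proof. by move=> xN; rewrite /entry insubF // index_mem (negbTE xN). Qed.

Lemma mem_nthP (N : seq nat) x : x \in N -> exists t : 'I_(size N), x = nth 0%N N t.
Proof.
by move=> xN; have xlt := xN; rewrite -index_mem in xlt; exists (Ordinal xlt); rewrite /= nth_index.
Qed.

Lemma twistor_comp k (A : 'M[R]_(k, k + 4)) z (h : nat -> nat) (I : twidx) :
  twistor A (z \o h) I = twistor A z [tuple of map h I].
Proof.
by congr (\det (col_mx _ _)); apply/row_matrixP => i; rewrite !rowK tnth_map.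
Qed.
End LabelledMatrices.

(** * Transport of vanishing along linear maps *)

Section Transport.
Context {R : realType} {k : nat}.

Lemma mulmxr_continuous m n p (E : 'M[R]_(n, p)) :
  continuous (fun A : 'M[R]_(m, n) => A *m E).
Proof.
move=> A; apply: (@cvg_mx R _ (nbhs A) (nbhs_filter A)) => i j; rewrite mxE.
under eq_fun do rewrite mxE.
by apply: cvg_sumr => l _; apply: cvgM; [exact: coord_continuous|exact: cvg_cst].
Qed.

(** Right multiplication by an invertible matrix is a homeomorphism, so it is compatible with
    closures. *)
Lemma closure_mulr m n (E : 'M[R]_n) (U U' : set 'M[R]_(m, n)) A :
  E \in unitmx -> (forall B, U' (B *m E) -> U B) ->
  closure U' (A *m E) -> closure U A.
Proof.
move=> Eu U'U cA W AW.
have [|B [U'B WB]] := cA (fun B => W (B *m invmx E)).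
  by apply: (@mulmxr_continuous _ _ _ (invmx E)); rewrite mulmxK.
exists (B *m invmx E); split=> //; apply: U'U.
by rewrite mulmxKV.
Qed.

(** In [D *m A *m G *m Z] the factor [D] only changes the representative, and [G] is absorbed into
    [Z]. The matrix [E] allows a change of basis of the ambient space. *)
Lemma reps_tilde_image m m' (S : set (Gr R k m)) (f : 'M[R]_(k, m) -> 'M[R]_(k, m'))
    (D : 'M[R]_k) (G : 'M[R]_(m, m')) (Z : 'M[R]_(m', k + 4)) (E : 'M[R]_(k + 4))
    (Z' : 'M[R]_(m, k + 4)) :
  D \in unitmx -> E \in unitmx -> (forall A, f A = D *m A *m G) ->
  G *m Z *m E = Z' ->
  forall B, reps (tilde Z (image_by f S)) B <-> reps (tilde Z' S) (B *m E).
Proof.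
move=> Du Eu fE ZE B; split.
  move=> [Y [W [C [[V [A [SV VA WA]] WC YC]]]] YB].
  have [g gu CE] := represents_eq WA WC; have [h hu BE] := represents_eq YC YB.
  have BfE : row_free (B *m E).
    by rewrite /row_free mxrankMfree ?row_free_unit // (eqP (represents_row_free YB)).
  have [Y' Y'B] := row_free_represents BfE.
  have BEE : B *m E = (h *m g *m D *m A) *m Z'.
    by rewrite BE CE fE -ZE !mulmxA.
  exists Y' => //; exists V, (h *m g *m D *m A); split=> //.
    by apply: represents_mul => //; rewrite !unitmx_mul hu gu.
  by rewrite -BEE.
move=> [Y' [V [C [SV VC Y'C]]] Y'B].
have [h hu BE] := represents_eq Y'C Y'B.
have {}BE : B = h *m invmx D *m (f C *m Z).
  rewrite -[LHS](mulmxK Eu) BE -ZE fE !mulmxA mulmxK // -[h *m _ *m D]mulmxA mulVmx //.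
  by rewrite mulmx1.
have Bfree : row_free B.
  have := represents_row_free Y'B; rewrite /row_free mxrankMfree ?row_free_unit //.
have [Y YB] := row_free_represents Bfree.
have hDu : h *m invmx D \in unitmx by rewrite unitmx_mul hu unitmx_inv.
have YfC : represents Y (f C *m Z).
  have -> : f C *m Z = invmx (h *m invmx D) *m B by rewrite BE mulKmx.
  by apply: represents_mul => //; rewrite unitmx_inv.
(* [f C] represents a point only if it has full rank, which it inherits from the product
   [f C *m Z]. *)
have fCfree : row_free (f C).
  have := represents_row_free YfC; rewrite /row_free => /eqP e.
  by rewrite eqn_leq rank_leq_row -{1}e mxrankM_maxl.
have [W WfC] := row_free_represents fCfree.
by exists Y => //; exists W, (f C); split=> //; exists V, C.
Qed.

(** Multiplication by [E] matches the two sets of representatives and hence their closures.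
    Numerator and denominator change by nonzero constants, so both the domain and the zeros
    correspond. *)
Lemma rvanishes_transport N N' (S : set (Gr R k (size N))) (S' : set (Gr R k (size N')))
    (Z : 'M[R]_(size N', k + 4)) (Z' : 'M[R]_(size N, k + 4)) (E : 'M[R]_(k + 4))
    (P Q P' Q' : twpoly R) (c c' : R) :
  E \in unitmx -> c != 0 -> c' != 0 ->
  (forall B, reps (tilde Z S') B <-> reps (tilde Z' S) (B *m E)) ->
  (forall A, tweval (twistor A (lrow Z)) P' = c * tweval (twistor (A *m E) (lrow Z')) P) ->
  (forall A, tweval (twistor A (lrow Z)) Q' = c' * tweval (twistor (A *m E) (lrow Z')) Q) ->
  rvanishes Z' S P Q -> rvanishes Z S' P' Q'.
Proof.
move=> Eu c0 c'0 TT' PE QE [dense zero].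
have clE B : closure (reps (tilde Z S')) B <-> closure (reps (tilde Z' S)) (B *m E).
  split; last by apply: closure_mulr => // B' /TT'.
  rewrite -{1}(mulmxK Eu B); apply: closure_mulr; rewrite ?unitmx_inv // => B' /TT'.
  by rewrite mulmxKV.
have freeE (B : 'M[R]_(k, k + 4)) : row_free (B *m E) = row_free B.
  by rewrite /row_free mxrankMfree ?row_free_unit.
split.
  move=> Y XY; have [A YA] := Gr_represents Y.
  have [Y' Y'A] : exists Y', represents Y' (A *m E).
    by apply: row_free_represents; rewrite freeE (represents_row_free YA).
  apply/(closure_Gr _ YA).
  have /dense/(closure_Gr _ Y'A) : Zimage Z' S Y'.
    by apply/(closure_Gr _ Y'A)/clE/(closure_Gr _ YA).
  apply: closure_mulr => // B [Y1 [XY1 [A1 Y1A1 domA1]] Y1B].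
  have [g gu A1E] := represents_eq Y1B Y1A1.
  have [Y2 Y2B] : exists Y2, represents Y2 B.
    by apply: row_free_represents; rewrite -freeE (represents_row_free Y1B).
  exists Y2 => //; split.
    by apply/(closure_Gr _ Y2B)/clE/(closure_Gr _ Y1B).
  (* The denominator is known to be nonzero at [A1], which may differ from [B *m E] by [g]; the
     witness on this side is adjusted accordingly. *)
  exists (g *m B); first exact: represents_mul.
  by rewrite QE -mulmxA -A1E mulf_neq0.
move=> Y A XY YA; rewrite QE mulf_eq0 negb_or => /andP[_ QA].
have [Y' Y'A] : exists Y', represents Y' (A *m E).
  by apply: row_free_represents; rewrite freeE (represents_row_free YA).
have XY' : Zimage Z' S Y' by apply/(closure_Gr _ Y'A)/clE/(closure_Gr _ YA).
have /eqP := zero _ _ XY' Y'A QA; rewrite mulf_eq0 invr_eq0 (negbTE QA) orbF => /eqP PA.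
by rewrite PE PA mulr0 mul0r.
Qed.
End Transport.

(** * Insertion of zero columns *)

Section Pre.
Context {R : realType} {k : nat}.
Variables (N I : seq nat) (Z : 'M[R]_(size (sort leq (N ++ I)), k + 4)).
Hypotheses (Nset : index_set N) (Iset : index_set I) (NI : ~~ has (mem N) I).
Let N' := sort leq (N ++ I).

Lemma sort_cat_sorted : sorted ltn N'.
Proof.
rewrite ltn_sorted_uniq_leq sort_uniq cat_uniq !index_set_uniq // NI /=.
by apply: sort_sorted; exact: leq_total.
Qed.

Lemma sort_cat_index (s : 'I_(size N)) : (index (nth 0%N N s) N' < size N')%N.
Proof. by rewrite index_mem mem_sort mem_cat mem_nth. Qed.

Definition pre_pos s : 'I_(size N') := Ordinal (sort_cat_index s).

Lemma pre_pos_nth s : nth 0%N N' (pre_pos s) = nth 0%N N s.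
Proof. by rewrite nth_index // mem_sort mem_cat mem_nth. Qed.

Lemma increasing_pre_pos : increasing pre_pos.
Proof.
move=> i j ij; rewrite ltnNge; apply/negP => ji.
have : (nth 0%N N' (pre_pos j) <= nth 0%N N' (pre_pos i))%N.
  have srt : sorted leq N' by apply: sort_sorted; exact: leq_total.
  exact: (sorted_leq_nth leq_trans leqnn 0%N srt _ _ (sort_cat_index j) (sort_cat_index i) ji).
rewrite !pre_pos_nth leqNgt.
by rewrite (sorted_ltn_nth ltn_trans 0%N (path_sorted Nset)) // inE.
Qed.

Lemma pre_mxE (A : 'M[R]_(k, size N)) :
  pre_mx I A = A *m (\matrix_(s, t) (t == pre_pos s)%:R).
Proof.
have uN' : uniq N' by apply: (sorted_uniq ltn_trans ltnn); exact: sort_cat_sorted.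
apply/matrixP => i t; rewrite !mxE.
have [|xN] := boolP (nth 0%N N' t \in N); last first.
  rewrite entry_out // big1 // => s _; rewrite mxE.
  case: eqP => [e|_]; last by rewrite mulr0.
  by move: xN; rewrite e pre_pos_nth mem_nth.
move=> /mem_nthP[s0 s0E]; rewrite s0E entry_nth ?index_set_uniq //.
have ts (s : 'I_(size N)) : (t == pre_pos s) = (s == s0).
  rewrite -val_eqE -(nth_uniq 0%N _ _ uN') ?ltn_ord // pre_pos_nth s0E.
  by rewrite nth_uniq ?index_set_uniq // eq_sym.
rewrite (bigD1 s0) //= mxE ts eqxx mulr1 big1 ?addr0 // => s ss0.
by rewrite mxE ts (negbTE ss0) mulr0.
Qed.

(** Zero columns of [C] drop the rows of [Z] labelled by [I]. The minors of the remaining rows are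
    minors of [Z], and the twistor coordinates with labels in [N] do not change. *)
Lemma rvanishes_pre (S : set (Gr R k (size N))) P Q :
  functionary N P -> functionary N Q -> Mat_pos Z ->
  (forall Z' : 'M[R]_(size N, k + 4), Mat_pos Z' -> rvanishes Z' S P Q) ->
  rvanishes Z (pre I S) P Q.
Proof.
move=> NP NQ Zpos vanS.
have uN' : uniq N' by apply: (sorted_uniq ltn_trans ltnn); exact: sort_cat_sorted.
have Z'pos : Mat_pos (rowsub pre_pos Z).
  move=> J Jincr; have -> : rowsub J (rowsub pre_pos Z) = rowsub (pre_pos \o J) Z.
    by apply/matrixP => i j; rewrite !mxE.
  by apply: Zpos => i j ij; apply/increasing_pre_pos/Jincr.
have twE (A : 'M[R]_(k, k + 4)) (J : twidx) : sorted ltn J -> all (mem N) J ->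
    twistor A (lrow Z) J = twistor (A *m 1%:M) (lrow (rowsub pre_pos Z)) J.
  move=> _ /allP JN; rewrite mulmx1; apply: eq_twistor => x /JN /mem_nthP[s ->].
  rewrite lrow_nth ?index_set_uniq // -pre_pos_nth lrow_nth //.
  by apply/rowP => j; rewrite !mxE.
have fevE A F : functionary N F -> tweval (twistor A (lrow Z)) F =
    1 * tweval (twistor (A *m 1%:M) (lrow (rowsub pre_pos Z))) F.
  by move=> NF; rewrite mul1r; apply: (eq_in_tweval NF) => J; apply: twE.
apply: (rvanishes_transport (unitmx1 _ _) (oner_neq0 _) (oner_neq0 _) _ _ _ (vanS _ Z'pos)).
- apply: (@reps_tilde_image R k _ _ S (@pre_mx R k N I) 1%:M
    (\matrix_(s, t) (t == pre_pos s)%:R)); rewrite ?unitmx1 //.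
    by move=> A; rewrite mul1mx pre_mxE.
  rewrite mulmx1; apply/matrixP => s j; rewrite !mxE.
  rewrite (bigD1 (pre_pos s)) //= mxE eqxx mul1r big1 ?addr0 // => t ts.
  by rewrite mxE (negbTE ts) mul0r.
- by move=> A; apply: fevE.
- by move=> A; apply: fevE.
Qed.
End Pre.

(** * Cyclic shift *)

Section Cyc.
Context {R : realType}.

Lemma ordS_val m (i : 'I_m) : ordS i = (if i.+1 == m then 0 else i.+1)%N :> nat.
Proof.
rewrite /=; case: eqP => [->|/eqP im]; first by rewrite modnn.
by rewrite modn_small // ltn_neqAle im ltn_ord.
Qed.

(** This is the modified [Z] for the cyclic shift: [cyc_mx A *m Z = A *m cyc_rows c Z] with c =
    (-1)^(k+1). Only the row that wraps around carries the sign. *)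
Definition cyc_rows m p (c : R) (Z : 'M[R]_(m, p)) : 'M[R]_(m, p) :=
  \matrix_s ((if s.+1 == m then c else 1) *: row (ordS s) Z).

(* A cyclic shift of [p] rows has sign [(-1) ^+ p.-1]. *)
Lemma cyc_rows_pos m p q (Z : 'M[R]_(m, p)) : p = q.+1 ->
  (forall I : 'I_p -> 'I_m, increasing I -> 0 < \det (rowsub I Z)) ->
  forall I : 'I_p -> 'I_m, increasing I -> 0 < \det (rowsub I (cyc_rows ((-1) ^+ q) Z)).
Proof.
move=> e; subst p => Zpos I Iincr.
(* If the last row is not selected, nothing wraps around and the successors are an increasing
   selection of rows of [Z]. *)
have [Imax|Imax] := eqVneq (I ord_max).+1 m; last first.
  have Ilt i : ((I i).+1 < m)%N.
    rewrite ltn_neqAle ltn_ord andbT; apply/negP => /eqP Ii.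
    have [i_max|i_max] := eqVneq i ord_max; first by rewrite -i_max Ii eqxx in Imax.
    have /Iincr : (i < (ord_max : 'I_q.+1))%N.
      by rewrite ltn_neqAle -val_eqE in i_max *; rewrite i_max /= -ltnS ltn_ord.
    by rewrite -ltnS Ii ltnNge ltn_ord.
  have -> : rowsub I (cyc_rows ((-1) ^+ q) Z) = rowsub (fun i => ordS (I i)) Z.
    by apply/matrixP => i j; rewrite !mxE ltn_eqF // mul1r.
  apply: Zpos => i j ij; rewrite !ordS_val !ltn_eqF // ltnS; exact: Iincr.
have Ilt (i j : 'I_q.+1) : (i < j)%N -> ((I i).+1 < m)%N.
  by move=> /Iincr ij; apply: leq_ltn_trans ij (ltn_ord _).
(* Now the last selected row is row 0 of [Z] up to sign. [J] lists the selected rows of [Z] in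
   increasing order, with this one first. *)
pose J i := ordS (I (ord_pred i)).
have predE (i : 'I_q.+1) : ord_pred i = (if i == 0%R then q else i.-1)%N :> nat.
  case: (i) => [[|i'] Hi] //=; first by rewrite modn_small.
  by rewrite modnDr modn_small // ltnW.
have J0 : J 0 = 0%N :> nat.
  rewrite /J ordS_val; have -> : ord_pred (0 : 'I_q.+1) = ord_max by apply/ord_inj; rewrite predE.
  by rewrite Imax eqxx.
have pred_lt (i j : 'I_q.+1) : i != 0 -> (i <= j)%N -> (ord_pred i < j)%N.
  move=> i0 ij; rewrite predE (negbTE i0); apply: leq_trans ij.
  by rewrite -val_eqE /= in i0; case: (nat_of_ord i) i0.
have JS (i : 'I_q.+1) : i != 0 -> J i = (I (ord_pred i)).+1 :> nat.
  by move=> i0; rewrite /J ordS_val ltn_eqF // (Ilt _ i) // pred_lt.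
have Jincr : increasing J.
  move=> i j ij; have j0 : j != 0 by rewrite -val_eqE /= -lt0n (leq_ltn_trans _ ij).
  rewrite (JS j) //; have [->|i0] := eqVneq i 0; first by rewrite J0.
  rewrite JS // ltnS; apply: Iincr; rewrite !predE (negbTE i0) (negbTE j0).
  by rewrite -val_eqE /= in i0; case: (nat_of_ord i) i0 ij => // i' _; case: (nat_of_ord j).
(* The sign of the wrapped row cancels the sign of moving it from the top to the bottom. *)
rewrite (@det_rowshift _ q ((-1) ^+ q) (rowsub J Z)).
- by rewrite -exprD addnn -signr_odd odd_double mul1r; apply: Zpos.
- have -> : (0 : 'I_q.+1) = ord0 by [].
  apply/rowP => j; rewrite !mxE Imax eqxx; congr (_ * Z _ _).
  by rewrite /J; congr ordS; congr I; apply/ord_inj; rewrite predE.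
move=> i; apply/rowP => j; rewrite !mxE.
have lift_max : lift ord_max i = i :> nat by rewrite /= /bump leqNgt ltn_ord.
have -> : ((I (lift ord_max i)).+1 == m) = false.
  by rewrite ltn_eqF // (Ilt _ ord_max) // lift_max /= ltn_ord.
rewrite mul1r /J; congr (Z _ _); congr ordS; congr I; apply/ord_inj.
by rewrite predE /= /bump leqNgt ltn_ord.
Qed.

Section CycVanishing.
Context {k : nat} (N : seq nat).
Hypothesis Nset : index_set N.

Lemma nth_lt (i j : 'I_(size N)) : (nth 0%N N i < nth 0%N N j)%N = (i < j)%N.
Proof.
have H (a b : 'I_(size N)) : (a < b)%N -> (nth 0%N N a < nth 0%N N b)%N.
  by move=> ab; apply: (sorted_ltn_nth ltn_trans 0%N (path_sorted Nset)); rewrite ?inE.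
case: (ltngtP i j) => [/H -> //|/H ji|/val_inj ->]; last by rewrite ltnn.
by apply/negbTE; rewrite -leqNgt ltnW.
Qed.

Lemma le_nth (i j : 'I_(size N)) : (i < j)%N -> (nth 0%N N i <= nth 0%N N j)%N.
Proof. by move=> ij; rewrite ltnW // nth_lt. Qed.

Lemma next_nth_ord (s : 'I_(size N)) : next N (nth 0%N N s) = nth 0%N N (ordS s).
Proof.
rewrite next_nth mem_nth // ordS_val index_uniq ?index_set_uniq //.
case: N s => [|y N'] s; first by case: s.
rewrite /= eqSS; case: eqP => [->|/eqP sN]; first by rewrite nth_default.
by apply: set_nth_default; rewrite ltn_neqAle sN -ltnS ltn_ord.
Qed.

Lemma perm_sort_leq (s t : seq nat) : perm_eq s t -> sorted leq t -> sort leq s = t.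
Proof.
move=> st t_sorted; rewrite -(sorted_sort leq_trans t_sorted).
by apply/perm_sortP => //; [exact: leq_total|exact: leq_trans|exact: anti_leq].
Qed.

(** As [I] is increasing, the last label of [N] can only be its fourth entry. Its successor is the
    first label, and sorting moves it past three others, with sign -1; together with the sign
    (-1)^(k+1) of [cyc_rows] this gives (-1)^k. The right-hand side has the shape that
    [tweval_scale] expects. *)
Lemma twistor_cyc (A : 'M[R]_(k, k + 4)) (Z : 'M[R]_(size N, k + 4)) (I : twidx) :
  sorted ltn I -> all (mem N) I ->
  twistor A (lrow Z) [tuple of sort leq (map (next N) I)] =
  1 * ((-1) ^+ k) ^+ count_mem (last 0%N N) I *
  twistor A (lrow (cyc_rows ((-1) ^+ k.+1) Z)) I.
Proof.
move=> Isort /allP IN; rewrite mul1r.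
pose sg x : R := if x == last 0%N N then (-1) ^+ k.+1 else 1.
have lrowE x : x \in N -> lrow (cyc_rows ((-1) ^+ k.+1) Z) x = sg x *: lrow Z (next N x).
  move=> /mem_nthP[s ->]; rewrite next_nth_ord !lrow_nth ?index_set_uniq // rowK.
  congr (_ *: _); rewrite /sg -nth_last nth_uniq ?index_set_uniq //; last first.
    by rewrite prednK // (leq_ltn_trans _ (ltn_ord s)).
  by rewrite -[in RHS]eqSS prednK // (leq_ltn_trans _ (ltn_ord s)).
have -> : twistor A (lrow (cyc_rows ((-1) ^+ k.+1) Z)) I =
    (\prod_(x <- I) sg x) * twistor A (lrow Z) [tuple of map (next N) I].
  by rewrite -twistor_comp -twistor_scale; apply: eq_twistor => x /IN; apply: lrowE.
case: I Isort IN => -[|a [|b [|c [|d [|? ?]]]]] // Hs Isort IN.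
have [[sa aE] [sb bE] [sc cE] [sd dE]] : [/\ exists s, a = nth 0%N N (s : 'I_(size N)),
   exists s, b = nth 0%N N (s : 'I_(size N)), exists s, c = nth 0%N N (s : 'I_(size N)) &
   exists s, d = nth 0%N N (s : 'I_(size N))].
  by split; apply: mem_nthP; apply: IN; rewrite !inE eqxx ?orbT.
have /and4P[ab bc cd _] : [&& sa < sb, sb < sc, sc < sd & true]%N.
  by move: Isort; rewrite /= aE bE cE dE !nth_lt.
have N0 : (0 < size N)%N by rewrite (leq_ltn_trans _ (ltn_ord sa)).
have lastE (s : 'I_(size N)) : (nth 0%N N s == last 0%N N) = (s.+1 == size N).
  by rewrite -nth_last nth_uniq ?index_set_uniq ?prednK // -eqSS prednK.
have nlast (s t : 'I_(size N)) : (s < t)%N -> (s.+1 == size N) = false.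
  by move=> st; rewrite ltn_eqF // (leq_ltn_trans st).
have sgE (s : 'I_(size N)) : sg (nth 0%N N s) = if s.+1 == size N then (-1) ^+ k.+1 else 1.
  by rewrite /sg lastE.
have SE (s t : 'I_(size N)) : (s < t)%N -> ordS s = s.+1 :> nat.
  by move=> st; rewrite ordS_val (nlast s t).
have mapE : map (next N) [:: a; b; c; d] = [:: nth 0%N N (ordS sa); nth 0%N N (ordS sb);
    nth 0%N N (ordS sc); nth 0%N N (ordS sd)].
  by rewrite /= aE bE cE dE !next_nth_ord.
have -> : \prod_(x <- Tuple Hs) sg x = if sd.+1 == size N then (-1) ^+ k.+1 else 1.
  rewrite /= !big_cons big_nil aE bE cE dE !sgE (nlast sa sb) // (nlast sb sc) // (nlast sc sd) //.
  by rewrite !mul1r mulr1.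
have -> : count_mem (last 0%N N) (Tuple Hs) = (sd.+1 == size N).
  rewrite /= aE bE cE dE !lastE (nlast sa sb) // (nlast sb sc) // (nlast sc sd) //.
  by rewrite !add0n addn0.
have -> : [tuple of map (next N) (Tuple Hs)] = [tuple nth 0%N N (ordS sa);
    nth 0%N N (ordS sb); nth 0%N N (ordS sc); nth 0%N N (ordS sd)].
  by apply: val_inj; exact: mapE.
have [dlast|dlast] := eqVneq sd.+1 (size N).
  have -> : [tuple of sort leq (map (next N) (Tuple Hs))] = [tuple nth 0%N N (ordS sd);
      nth 0%N N (ordS sa); nth 0%N N (ordS sb); nth 0%N N (ordS sc)].
    apply: val_inj; rewrite [LHS]/= -/(map (next N) [:: a; b; c; d]) mapE.
    apply: perm_sort_leq; first by rewrite -(perm_rot 3).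
    apply/and4P; split=> //; apply: le_nth; rewrite ?(SE sa sb) ?(SE sb sc) ?(SE sc sd) //.
    by rewrite ordS_val dlast eqxx.
  rewrite expr1 [in RHS]twistor_swap23 [in RHS]twistor_swap12 [in RHS]twistor_swap01.
  by rewrite exprS mulN1r !mulNr !mulrN !opprK mulrA -expr2 sqrr_sign mul1r.
rewrite expr0 !mul1r; congr (twistor _ _ _); apply: val_inj.
rewrite [LHS]/= -/(map (next N) [:: a; b; c; d]) mapE.
apply: perm_sort_leq; first exact: perm_refl.
have Sd : ordS sd = sd.+1 :> nat by rewrite ordS_val (negbTE dlast).
by apply/and4P; split=> //; apply: le_nth; rewrite ?Sd ?(SE sa sb) ?(SE sb sc) ?(SE sc sd).
Qed.

Lemma cyc_mxE (A : 'M[R]_(k, size N)) : cyc_mx A =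
  A *m (\matrix_(s, t) ((if t == 0%N :> nat then (-1) ^+ k.+1 else 1) * (t == ordS s)%:R)).
Proof.
apply/matrixP => i t; rewrite !mxE (bigD1 (ord_pred t)) //= mxE ord_predK eqxx mulr1.
rewrite big1 ?addr0.
  rewrite mulrC; congr (_ * _); case: eqP => // _.
  (* For positive [k] the exponents [k.-1] and [k.+1] have the same parity; for [k = 0] there is no
     row. *)
  by case: (k) i => [[]//|k' _]; rewrite /= !exprS mulN1r mulN1r opprK.
move=> s sp; rewrite mxE; have /negbTE -> : t != ordS s.
  by apply: contraNneq sp => ->; rewrite ordSK.
by rewrite !mulr0.
Qed.

Lemma rvanishes_cyc (Z : 'M[R]_(size N, k + 4)) (S : set (Gr R k (size N))) P Q :
  functionary N P -> functionary N Q -> pure P -> pure Q -> Mat_pos Z ->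
  (forall Z' : 'M[R]_(size N, k + 4), Mat_pos Z' -> rvanishes Z' S P Q) ->
  rvanishes Z (cyc S) (cyc_star N P) (cyc_star N Q).
Proof.
move=> NP NQ pP pQ Zpos vanS.
have Z'pos : Mat_pos (cyc_rows ((-1) ^+ k.+1) Z).
  (* [cyc_rows_pos] asks for an exponent one less than the size k + 4 of a maximal minor. *)
  have -> : (-1) ^+ k.+1 = (-1) ^+ (k + 3) :> R.
    by rewrite addn3 exprS [RHS]exprS exprS mulrA mulrNN !mul1r exprS.
  by apply: cyc_rows_pos => //; rewrite addn3 addn4.
have sg0 n : (-1) ^+ n != 0 :> R by rewrite signr_eq0.
have [eP [fP PE]] := tweval_scale (last 0%N N) NP pP.
have [eQ [fQ QE]] := tweval_scale (last 0%N N) NQ pQ.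
apply: (@rvanishes_transport _ _ _ _ _ _ _ _ 1%:M P Q _ _ (1 ^+ eP * ((-1) ^+ k) ^+ fP)
  (1 ^+ eQ * ((-1) ^+ k) ^+ fQ) _ _ _ _ _ _ (vanS _ Z'pos)).
- by rewrite unitmx1.
- by rewrite expr1n mul1r expf_neq0.
- by rewrite expr1n mul1r expf_neq0.
- apply: (@reps_tilde_image R k _ _ S (@cyc_mx R k _) 1%:M _); rewrite ?unitmx1 //.
    by move=> A; rewrite mul1mx cyc_mxE.
  rewrite mulmx1; apply/matrixP => s j; rewrite !mxE.
  rewrite (bigD1 (ordS s)) //= mxE eqxx mulr1 big1 ?addr0.
    congr (_ * _).
    by rewrite ordS_val; case: (s.+1 == size N).
  by move=> t /negbTE ts; rewrite mxE ts mulr0 mul0r.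
- move=> A; rewrite mulmx1 /cyc_star tweval_rename; apply: PE => I Is IN.
  exact: twistor_cyc.
- move=> A; rewrite mulmx1 /cyc_star tweval_rename; apply: QE => I Is IN.
  exact: twistor_cyc.
Qed.

(** * Reflection *)

Lemma ltn_rev_ord m (s t : 'I_m) : (s < t)%N -> (rev_ord t < rev_ord s)%N.
Proof. by move=> st; apply: ltn_sub2l => //; apply: leq_ltn_trans st (ltn_ord t). Qed.

Definition rev_rows m : 'M[R]_m := \matrix_(i, j) (j == rev_ord i)%:R.

Lemma rev_rows_mul m p (B : 'M[R]_(m, p)) : rev_rows m *m B = rowsub (@rev_ord m) B.
Proof.
apply/matrixP => i j; rewrite !mxE (bigD1 (rev_ord i)) //= mxE eqxx mul1r big1 ?addr0 //.
by move=> l /negbTE li; rewrite mxE li mul0r.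
Qed.

Lemma rev_rows_det m : \det (rev_rows m) * \det (rev_rows m) = 1.
Proof.
rewrite -det_mulmx rev_rows_mul -[RHS](det1 R m); congr (\det _).
by apply/matrixP => i j; rewrite !mxE rev_ordK eq_sym.
Qed.

(** Reversing four indices is an even permutation, so sorting costs no sign. The determinant is that
    of the change of basis, and the power of 1 only gives the shape of [tweval_scale]. *)
Lemma twistor_refl (A : 'M[R]_(k, k + 4)) (Z : 'M[R]_(size N, k + 4)) (I : twidx) :
  sorted ltn I -> all (mem N) I ->
  twistor A (lrow Z)
    [tuple of sort leq (map (fun x => nth 0%N (rev N) (index x N)) I)] =
  \det (rev_rows (k + 4)) * 1 ^+ count_mem 0%N I *
  twistor (A *m rev_rows _) (lrow (rowsub (@rev_ord _) Z *m rev_rows _)) I.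
Proof.
move=> Isort /allP IN; rewrite expr1n mulr1.
pose rho x := nth 0%N (rev N) (index x N).
have rhoE (s : 'I_(size N)) : rho (nth 0%N N s) = nth 0%N N (rev_ord s).
  by rewrite /rho index_uniq ?index_set_uniq // nth_rev.
have lrowE x : x \in N ->
    lrow (rowsub (@rev_ord _) Z *m rev_rows _) x = lrow Z (rho x) *m rev_rows _.
  move=> /mem_nthP[s ->]; rewrite rhoE !lrow_nth ?index_set_uniq // row_mul; congr (_ *m _).
  by apply/rowP => j; rewrite !mxE.
have -> : twistor (A *m rev_rows _) (lrow (rowsub (@rev_ord _) Z *m rev_rows _)) I =
    \det (rev_rows (k + 4)) * twistor A (lrow Z) [tuple of map rho I].
  by rewrite -twistor_comp -twistor_mulr; apply: eq_twistor => x /IN; apply: lrowE.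
rewrite mulrA rev_rows_det mul1r.
case: I Isort IN => -[|a [|b [|c [|d [|? ?]]]]] // Hs Isort IN.
have [[sa aE] [sb bE] [sc cE] [sd dE]] : [/\ exists s, a = nth 0%N N (s : 'I_(size N)),
   exists s, b = nth 0%N N (s : 'I_(size N)), exists s, c = nth 0%N N (s : 'I_(size N)) &
   exists s, d = nth 0%N N (s : 'I_(size N))].
  by split; apply: mem_nthP; apply: IN; rewrite !inE eqxx ?orbT.
have /and4P[ab bc cd _] : [&& sa < sb, sb < sc, sc < sd & true]%N.
  by move: Isort; rewrite /= aE bE cE dE !nth_lt.
have mapE : map rho [:: a; b; c; d] = [:: nth 0%N N (rev_ord sa); nth 0%N N (rev_ord sb);
    nth 0%N N (rev_ord sc); nth 0%N N (rev_ord sd)].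
  by rewrite [LHS]/= aE bE cE dE !rhoE.
have -> : [tuple of map rho (Tuple Hs)] = [tuple nth 0%N N (rev_ord sa);
    nth 0%N N (rev_ord sb); nth 0%N N (rev_ord sc); nth 0%N N (rev_ord sd)].
  by apply: val_inj; exact: mapE.
have -> : [tuple of sort leq (map rho (Tuple Hs))] = [tuple nth 0%N N (rev_ord sd);
    nth 0%N N (rev_ord sc); nth 0%N N (rev_ord sb); nth 0%N N (rev_ord sa)].
  apply: val_inj; rewrite [LHS]/= -/(map rho [:: a; b; c; d]) mapE.
  apply: perm_sort_leq.
    by rewrite -[X in perm_eq _ X]/(rev [:: nth 0%N N (rev_ord sa); nth 0%N N (rev_ord sb);
      nth 0%N N (rev_ord sc); nth 0%N N (rev_ord sd)]) perm_sym perm_rev.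
  by apply/and4P; split=> //; apply: le_nth; apply: ltn_rev_ord.
rewrite [in RHS]twistor_swap23 [in RHS]twistor_swap12 [in RHS]twistor_swap01.
rewrite [in RHS]twistor_swap23 [in RHS]twistor_swap12 [in RHS]twistor_swap23.
by rewrite !opprK.
Qed.

(** Reversing the order of the rows of [Z] multiplies every maximal minor by the sign
    [\det (rev_rows (k + 4))]; reversing the ambient coordinates as well restores positivity. The
    diagonal matrix [D] below absorbs the sign of the first row. *)
Lemma rvanishes_refl (Z : 'M[R]_(size N, k + 4)) (S : set (Gr R k (size N))) P Q :
  functionary N P -> functionary N Q -> pure P -> pure Q -> Mat_pos Z ->
  (forall Z' : 'M[R]_(size N, k + 4), Mat_pos Z' -> rvanishes Z' S P Q) ->
  rvanishes Z (refl S) (refl_star N P) (refl_star N Q).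
Proof.
move=> NP NQ pP pQ Zpos vanS.
have detE := rev_rows_det (k + 4).
have detE0 : \det (rev_rows (k + 4)) != 0.
  by apply/eqP => e0; move/eqP: detE; rewrite e0 mul0r eq_sym oner_eq0.
have Z'pos : Mat_pos (rowsub (@rev_ord _) Z *m rev_rows (k + 4)).
  move=> I Iincr; rewrite -mul_rowsub_mx.
  have -> : rowsub I (rowsub (@rev_ord _) Z) =
      rev_rows _ *m rowsub (fun i => rev_ord (I (rev_ord i))) Z.
    by rewrite rev_rows_mul; apply/matrixP => i j; rewrite !mxE rev_ordK.
  rewrite !det_mulmx mulrAC detE mul1r; apply: Zpos => i j ij.
  by apply/ltn_rev_ord/Iincr/ltn_rev_ord.
have [eP [fP PE]] := tweval_scale 0%N NP pP.
have [eQ [fQ QE]] := tweval_scale 0%N NQ pQ.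
apply: (@rvanishes_transport _ _ _ _ _ _ _ _ (rev_rows _) P Q _ _
  (\det (rev_rows (k + 4)) ^+ eP * 1 ^+ fP)
  (\det (rev_rows (k + 4)) ^+ eQ * 1 ^+ fQ) _ _ _ _ _ _ (vanS _ Z'pos)).
- by rewrite unitmxE unitfE.
- by rewrite expr1n mulr1 expf_neq0.
- by rewrite expr1n mulr1 expf_neq0.
- pose D : 'M[R]_k := diag_mx (\row_i (if i == 0%N :> nat then (-1) ^+ 'C(k, 2) else 1)).
  apply: (@reps_tilde_image R k _ _ S (@refl_mx R k _) D (rev_rows _)).
  + rewrite unitmxE unitfE det_diag; apply/prodf_neq0 => i _; rewrite mxE.
    by case: ifP; rewrite ?signr_eq0 ?oner_eq0.
  + by rewrite unitmxE unitfE.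
  + move=> A; apply/matrixP => i t; rewrite mul_diag_mx.
    rewrite !mxE (bigD1 (rev_ord t)) //= !mxE rev_ordK eqxx mulr1 big1 ?addr0 //.
    move=> s st; rewrite !mxE; have /negbTE -> : t != rev_ord s.
      by apply: contraNneq st => ->; rewrite rev_ordK.
    by rewrite mulr0.
  + by rewrite rev_rows_mul.
- move=> A; rewrite /refl_star tweval_rename; apply: PE => I Is IN.
  exact: twistor_refl.
- move=> A; rewrite /refl_star tweval_rename; apply: QE => I Is IN.
  exact: twistor_refl.
Qed.
End CycVanishing.
End Cyc.

(** * Zariski density of the positive matrices *)

Section ZariskiDensity.
Context {R : realType}.

(** Density is only used along lines of matrices, so polynomials in one variable suffice. *)
Definition polyfun (f : R -> R) := exists p : {poly R}, forall t, f t = p.[t].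

Lemma polyfun_cst c : polyfun (fun=> c).
Proof. by exists c%:P => t; rewrite hornerC. Qed.

Lemma polyfunD f g : polyfun f -> polyfun g -> polyfun (fun t => f t + g t).
Proof. by move=> [p pE] [q qE]; exists (p + q) => t; rewrite hornerD pE qE. Qed.

Lemma polyfunM f g : polyfun f -> polyfun g -> polyfun (fun t => f t * g t).
Proof. by move=> [p pE] [q qE]; exists (p * q) => t; rewrite hornerM pE qE. Qed.

Lemma polyfun_affine a b : polyfun (fun t => a + t * b).
Proof. by exists (a%:P + 'X * b%:P) => t; rewrite !hornerE. Qed.

Lemma eq_polyfun f g : f =1 g -> polyfun f -> polyfun g.
Proof. by move=> fg [p pE]; exists p => t; rewrite -fg. Qed.

Lemma polyfun_sum (I : Type) (r : seq I) (P : pred I) (f : I -> R -> R) :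
  (forall i, P i -> polyfun (f i)) -> polyfun (fun t => \sum_(i <- r | P i) f i t).
Proof.
move=> fp; elim: r => [|i r IHr].
  by apply: eq_polyfun (polyfun_cst 0) => t; rewrite big_nil.
have [Pi|Pi] := boolP (P i).
  by apply: eq_polyfun (polyfunD (fp i Pi) IHr) => t; rewrite big_cons Pi.
by apply: eq_polyfun IHr => t; rewrite big_cons (negbTE Pi).
Qed.

Lemma polyfun_prod (I : Type) (r : seq I) (P : pred I) (f : I -> R -> R) :
  (forall i, P i -> polyfun (f i)) -> polyfun (fun t => \prod_(i <- r | P i) f i t).
Proof.
move=> fp; elim: r => [|i r IHr].
  by apply: eq_polyfun (polyfun_cst 1) => t; rewrite big_nil.
have [Pi|Pi] := boolP (P i).
  by apply: eq_polyfun (polyfunM (fp i Pi) IHr) => t; rewrite big_cons Pi.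
by apply: eq_polyfun IHr => t; rewrite big_cons (negbTE Pi).
Qed.

Lemma polyfunX f n : polyfun f -> polyfun (fun t => f t ^+ n).
Proof. by move=> [p pE]; exists (p ^+ n) => t; rewrite horner_exp pE. Qed.

Lemma polyfun_det n (M : R -> 'M[R]_n) :
  (forall i j, polyfun (fun t => M t i j)) -> polyfun (fun t => \det (M t)).
Proof.
move=> Mp; apply: polyfun_sum => s _; apply: polyfunM; first exact: polyfun_cst.
by apply: polyfun_prod => i _.
Qed.

Lemma polyfun_tweval (v : R -> twidx -> R) P :
  (forall I, polyfun (v^~ I)) -> polyfun (fun t => tweval (v t) P).
Proof.
move=> vp; apply: polyfun_sum => m _; apply: polyfunM; first exact: polyfun_cst.
by apply: polyfun_prod => I _; apply: polyfunX.
Qed.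

Lemma poly_nonroot_near0 (p : {poly R}) (U : set R) :
  p != 0 -> nbhs 0 U -> exists2 t, U t & p.[t] != 0.
Proof.
move=> p0 /nbhs_ballP[e /= e0 eU]; apply: contrapT => H.
(* These [size p] distinct points are one more than the degree of [p]; starting at [e / 2] keeps
   them inside the open ball. *)
pose rs := [seq e / i.+2%:R | i <- iota 0 (size p)].
have : (size rs < size p)%N.
  apply: max_poly_roots => //; last first.
    rewrite map_inj_uniq ?iota_uniq // => i j.
    move/(mulfI (lt0r_neq0 e0))/invr_inj/eqP; rewrite eqr_nat => /eqP; by case.
  apply/allP => _ /mapP[i _ ->]; apply/negPn/negP => pt; apply: H.
  exists (e / i.+2%:R) => //; apply: eU.
  rewrite /ball /= sub0r normrN gtr0_norm ?divr_gt0 // ltr_pdivrMr //.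
  by rewrite ltr_pMr // ltr1n.
by rewrite size_map size_iota ltnn.
Qed.

(** Positivity consists of finitely many strict inequalities between continuous functions. The
    finite functions in [H] make the finiteness available to the filter. *)
Lemma Mat_pos_near m k (Z W : 'M[R]_(m, k + 4)) : Mat_pos Z ->
  \forall t \near (0 : R), Mat_pos (Z + t *: W).
Proof.
move=> Zpos.
have H : \forall t \near (0 : R), forall I : {ffun 'I_(k + 4) -> 'I_m},
    increasing I -> 0 < \det (rowsub I (Z + t *: W)).
  apply: (@filter_forall R _ (fun (I : {ffun 'I_(k + 4) -> 'I_m}) t =>
    increasing I -> 0 < \det (rowsub I (Z + t *: W))) (nbhs (0 : R)) _) => I.
  have [Iincr|NI] := pselect (increasing I); last by near=> t => /NI.
  have cvgI : \det (rowsub I (Z + t *: W)) @[t --> (0 : R)] --> \det (rowsub I Z).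
    apply: cvg_det; apply: cvg_mx => i j; rewrite mxE.
    under eq_fun do rewrite !mxE.
    have : Z (I i) j + t * W (I i) j @[t --> (0 : R)] --> Z (I i) j + 0 * W (I i) j.
      apply: cvgD; first exact: cvg_cst.
      by apply: cvgM; [exact: cvg_id|exact: cvg_cst].
    by rewrite mul0r addr0.
  by apply: filterS (cvgr_gt _ cvgI _ (Zpos _ Iincr)) => t.
apply: filterS H => t Ht I Iincr.
have := Ht (finfun I); have /eq_rowsub -> : finfun I =1 I by move=> i; rewrite ffunE.
by apply=> i j ij; rewrite !ffunE; exact: Iincr.
Unshelve. all: by end_near. Qed.

(** Suppose the value at [Z1] is nonzero. The leading minor [del] is nonzero at some [Z2], so on the
    line through [Z1] and [Z2] there is a point [Z3] where both are nonzero. On the line from a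
    positive [Z0] to [Z3] their product is a nonzero polynomial, so it is nonzero at some positive
    matrix near [Z0]. There [A *m Z] has full rank and represents a point of the image,
    contradicting the vanishing. *)
Lemma fvanishes_all k (N : seq nat) (S : set (Gr R k (size N))) F :
  (forall Z : 'M[R]_(size N, k + 4), Mat_pos Z -> fvanishes Z S F) ->
  forall V A, S V -> represents V A ->
  forall Z : 'M[R]_(size N, k + 4), tweval (twistor (A *m Z) (lrow Z)) F = 0.
Proof.
move=> vanS V A SV VA Z1; apply/eqP/negPn/negP => vZ1.
pose val (Z : 'M[R]_(size N, k + 4)) := tweval (twistor (A *m Z) (lrow Z)) F.
pose del (Z : 'M[R]_(size N, k + 4)) := \det (lsubmx (A *m Z)).
have line_entry (Z W : 'M[R]_(size N, k + 4)) i j : polyfun (fun t => (Z + t *: W) i j).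
  by apply: eq_polyfun (polyfun_affine (Z i j) (W i j)) => t; rewrite !mxE.
have line_mul (Z W : 'M[R]_(size N, k + 4)) i j : polyfun (fun t => (A *m (Z + t *: W)) i j).
  have : polyfun (fun t => \sum_l A i l * (Z + t *: W) l j).
    by apply: polyfun_sum => l _; apply: polyfunM; [exact: polyfun_cst|exact: line_entry].
  by apply: eq_polyfun => t; rewrite [RHS]mxE.
have line_val Z W : polyfun (fun t => val (Z + t *: W)).
  apply: polyfun_tweval => I; apply: polyfun_det => i j.
  case: (fintype.splitP i) => l il.
    apply: eq_polyfun (line_mul Z W l j) => t.
    by rewrite (_ : i = lshift _ l) ?col_mxEu //; apply/val_inj.
  have : polyfun (fun t => lrow (Z + t *: W) (tnth I l) 0 j).
    (* A label outside [N] has the zero row, which is constant along the line. *)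
    rewrite /lrow; case: insub => [s|] /=; last exact: polyfun_cst.
    by apply: eq_polyfun (line_entry Z W s j) => t; rewrite [RHS]mxE.
  apply: eq_polyfun => t.
  by rewrite (_ : i = rshift _ l) ?col_mxEd ?mxE //; apply/val_inj.
have line_del Z W : polyfun (fun t => del (Z + t *: W)).
  apply: polyfun_det => i j; apply: eq_polyfun (line_mul Z W i (lshift 4 j)) => t.
  by rewrite [RHS]mxE.
have line_prod Z W : polyfun (fun t => val (Z + t *: W) * del (Z + t *: W)).
  exact: polyfunM.
have [Z2 dZ2] : exists Z2, del Z2 != 0.
  (* Since [A] is row free, it times its pseudo-inverse is the identity, so the leading minor is
     1. *)
  exists (pinvmx A *m row_mx 1%:M 0).
  by rewrite /del mulmxA mulmxVp ?(represents_row_free VA) // mul1mx row_mxKl det1 oner_eq0.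
have [Z3 vdZ3] : exists Z3, val Z3 * del Z3 != 0.
  have [p pE] := line_val Z1 (Z2 - Z1); have [q qE] := line_del Z1 (Z2 - Z1).
  have p0 : p != 0.
    apply/eqP => p0; move: vZ1; rewrite -/(val Z1) -[Z1]addr0 -(scale0r (Z2 - Z1)).
    by rewrite pE p0 horner0 eqxx.
  have q0 : q != 0.
    apply/eqP => q0; move: dZ2; have -> : Z2 = Z1 + 1 *: (Z2 - Z1) by rewrite scale1r addrC subrK.
    by rewrite qE q0 horner0 eqxx.
  have [t _ pqt] := poly_nonroot_near0 (mulf_neq0 p0 q0) filterT.
  by exists (Z1 + t *: (Z2 - Z1)); rewrite pE qE -hornerM.
have [Z0 Z0pos] := Mat_pos_nonempty (R := R) (size N) k.
have [p pE] := line_prod Z0 (Z3 - Z0).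
have p0 : p != 0.
  apply/eqP => p0; move: vdZ3; have -> : Z3 = Z0 + 1 *: (Z3 - Z0) by rewrite scale1r addrC subrK.
  by rewrite pE p0 horner0 eqxx.
have [t Zpos] := poly_nonroot_near0 p0 (Mat_pos_near (Z3 - Z0) Z0pos).
rewrite -pE mulf_eq0 negb_or => /andP[vt dt].
set Z := Z0 + _ in Zpos vt dt.
have AZfree : row_free (A *m Z).
  rewrite /row_free eqn_leq rank_leq_row /=.
  apply: leq_trans (mxrankM_maxl _ (col_mx 1%:M 0)).
  rewrite -[A *m Z]hsubmxK mul_row_col mulmx1 mulmx0 addr0.
  by move: dt; rewrite det_eq0_row_free => /eqP ->.
have [Y YA] := row_free_represents AZfree.
have [_ /(_ Y (A *m Z))] := vanS Z Zpos.
move=> /(_ (subset_closure _) YA I) v0; move: vt; rewrite /val v0 ?eqxx //.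
by exists V, A.
Qed.
End ZariskiDensity.

(** * Positivity of interleaved determinants *)

Section InterleavedMinors.
Context {R : realType}.

Lemma det_zero_col n (A : 'M[R]_n) j : (forall i, A i j = 0) -> \det A = 0.
Proof. by move=> A0; rewrite (expand_det_col _ j) big1 // => i _; rewrite A0 mul0r. Qed.

Lemma det_truncated_minor p m (A : 'M[R]_(p, m)) (P : pred 'I_m) (f : 'I_p -> 'I_m) :
  \det (colsub f (\matrix_(i, t) if P t then A i t else 0)) =
  if [forall i, P (f i)] then \det (colsub f A) else 0.
Proof.
case: forallP => [Pf|/existsNP[j /negP/negbTE Pj]].
  by congr (\det _); apply/matrixP => i j; rewrite !mxE Pf.
by apply: (@det_zero_col _ _ j) => i; rewrite !mxE Pj.
Qed.

(** The determinant is linear in each row, and Cauchy-Binet is applied first to the block of [A] and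
    then to that of [B]. What remains for each pair of nonzero minors is a minor of [Z] on rows in
    the increasing order phi f, ab, psi g, cdn, which is positive. *)
Lemma interleaved_row_full m n p1 p2 m1 m2 (Z : 'M[R]_(m, n))
    (A : 'M[R]_(p1, m1)) (phi : 'I_m1 -> 'I_m) (ab : 'I_2 -> 'I_m)
    (B : 'M[R]_(p2, m2)) (psi : 'I_m2 -> 'I_m) (cdn : 'I_3 -> 'I_m) :
  n = (p1 + 2 + p2 + 3)%N ->
  (forall I : 'I_n -> 'I_m, increasing I -> 0 < \det (rowsub I Z)) ->
  increasing phi -> increasing psi -> increasing ab -> increasing cdn ->
  (forall i j, ab i < cdn j)%N ->
  nonneg_minors A -> (exists2 f, increasing f & \det (colsub f A) != 0) ->
  nonneg_minors B -> (exists2 f, increasing f & \det (colsub f B) != 0) ->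
  (forall f, \det (colsub f A) != 0 -> forall i j, (phi (f i) < ab j)%N) ->
  (forall f, \det (colsub f B) != 0 -> forall i j, (ab j < psi (f i))%N) ->
  (forall f, \det (colsub f B) != 0 -> forall i j, (psi (f i) < cdn j)%N) ->
  row_full (col_mx (col_mx (col_mx (A *m rowsub phi Z) (rowsub ab Z))
    (B *m rowsub psi Z)) (rowsub cdn Z)).
Proof.
move=> e; subst n => Zpos phii psii abi cdni abcdn A0 A1 B0 B1 Aab abB Bcdn.
rewrite row_full_unit unitmxE unitfE; apply: lt0r_neq0.
pose D U := \det (col_mx (col_mx (col_mx U (rowsub ab Z)) (B *m rowsub psi Z)) (rowsub cdn Z)).
rewrite -/(D _); apply: det_rows_gt0 => // [|f fi fA].
  (* [P] restores the order of the blocks after the variable block has been placed on top, as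
     [det_fixed_rows] requires. *)
  pose P : 'M[R]_(p1 + 2 + p2 + 3, p1 + (2 + (p2 + 3))) :=
    col_mx (col_mx (col_mx (row_mx 1%:M 0) (row_mx 0 (row_mx 1%:M 0)))
      (row_mx 0 (row_mx 0 (row_mx 1%:M 0)))) (row_mx 0 (row_mx 0 (row_mx 0 1%:M))).
  have [|c [T PT]] := det_fixed_rows P
    (col_mx (rowsub ab Z) (col_mx (B *m rowsub psi Z) (rowsub cdn Z))).
    by rewrite !addnA.
  exists c, T => U; rewrite -PT /D.
  by rewrite !mul_col_mx !mul_row_col !mul1mx !mul0mx !addr0 !add0r.
pose D' V := \det (col_mx (col_mx (col_mx (rowsub f (rowsub phi Z)) (rowsub ab Z)) V)
  (rowsub cdn Z)).
rewrite /D -/(D' _); apply: det_rows_gt0 => // [|g gi gB].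
  pose P : 'M[R]_(p1 + 2 + p2 + 3, p2 + (p1 + (2 + 3))) :=
    col_mx (col_mx (col_mx (row_mx 0 (row_mx 1%:M 0)) (row_mx 0 (row_mx 0 (row_mx 1%:M 0))))
      (row_mx 1%:M 0)) (row_mx 0 (row_mx 0 (row_mx 0 1%:M))).
  have [|c [T PT]] := det_fixed_rows P
    (col_mx (rowsub f (rowsub phi Z)) (col_mx (rowsub ab Z) (rowsub cdn Z))).
    by rewrite [RHS]addnC -!addnA; congr (_ + (_ + _))%N; rewrite addnC.
  exists c, T => V; rewrite -PT /D'.
  by rewrite !mul_col_mx !mul_row_col !mul1mx !mul0mx !addr0 !add0r.
rewrite /D' -!rowsub_comp -!rowsub_fcat; apply: Zpos.
have fab i j := Aab f fA i j; have abg i j := abB g gB i j; have gcdn i j := Bcdn g gB i j.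
have lt_fg i j : (phi (f i) < psi (g j))%N by apply: ltn_trans (fab i 0) (abg j 0).
have lt_fcdn i j : (phi (f i) < cdn j)%N by apply: ltn_trans (fab i 0) (abcdn 0 j).
apply: increasing_fcat => //; last first.
  move=> i j; rewrite {1}/fcat; case: fintype.split => i'; last exact: gcdn.
  by rewrite /fcat; case: fintype.split => i'' /=.
apply: increasing_fcat => //; last first.
- by move=> i j; rewrite {1}/fcat; case: fintype.split => i' /=.
- by move=> i j ij; apply: psii; apply: gi.
apply: increasing_fcat => // i j ij.
by apply: phii; apply: fi.
Qed.

End InterleavedMinors.

(** * Continuity of evaluation *)

Section FunctionaryLimits.
Context {R : realType} {T : Type} {F : set_system T} {FF : Filter F}.

(** Convergence is asked only for the coordinates occurring in [P], so that a substitution not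
    acting on [P] may have a vanishing denominator at the limit. *)
Lemma cvg_tweval (v : T -> twidx -> R) (w : twidx -> R) (P : twpoly R) :
  (forall m, m \in msupp P -> forall I, I \in finsupp m -> v x I @[x --> F] --> w I) ->
  tweval (v x) P @[x --> F] --> tweval w P.
Proof.
move=> vw; rewrite /tweval mmapE big_seq.
under eq_fun do rewrite mmapE big_seq.
apply: cvg_sumr => m mP; apply: cvgM; first exact: cvg_cst.
rewrite /monom_val big_seq.
under eq_fun do rewrite big_seq.
apply: cvg_prodr => I Im.
elim: (m I) => [|e IHe]; first exact: cvg_cst.
rewrite exprS; under eq_fun do rewrite exprS.
by apply: cvgM => //; apply: vw mP I Im.
Qed.

Lemma cvg_twistor k (A : T -> 'M[R]_(k, k + 4)) (A0 : 'M[R]_(k, k + 4))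
    (z : T -> nat -> 'rV[R]_(k + 4)) (z0 : nat -> 'rV[R]_(k + 4)) (I : twidx) :
  A @ F --> A0 -> (forall x, x \in (I : seq nat) -> z t x @[t --> F] --> z0 x) ->
  twistor (A t) (z t) I @[t --> F] --> twistor A0 z0 I.
Proof.
move=> AA0 zz0; apply: cvg_det; apply: cvg_col_mx => //.
apply: cvg_mx => i j; rewrite mxE.
under eq_fun do rewrite mxE.
by apply: cvg_entry; apply: zz0; apply: mem_tnth.
Qed.
End FunctionaryLimits.

Lemma occurs_mem (R : realType) (P : twpoly R) m (I : twidx) x :
  m \in msupp P -> I \in finsupp m -> x \in (I : seq nat) -> occurs x P.
Proof.
move=> mP Im xI; exists m => //; rewrite /index_deg (big_fsetD1 I) //=.
by rewrite addn_gt0 muln_gt0 lt0n cmE_neq0 Im -has_count has_pred1 xI.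
Qed.

(** * Matrix products as sums over labels *)

Section LabelledSums.
Context {R : realType}.

Lemma sum_pick (V : zmodType) (N : seq nat) a (u : V) : uniq N -> a \in N ->
  \sum_(x <- N) (if x == a then u else 0) = u.
Proof.
by move=> uN aN; rewrite (bigD1_seq a) //= eqxx big1 ?addr0 // => x /negbTE ->.
Qed.

Lemma row_mul_lrow p q N (g : 'I_p -> nat -> R) (Z : 'M[R]_(size N, q)) i : uniq N ->
  row i ((\matrix_(i, t) g i (nth 0%N N t)) *m Z) = \sum_(x <- N) g i x *: lrow Z x.
Proof.
move=> uN; rewrite row_mul mulmx_sum_row (big_nth 0%N) big_mkord.
by apply: eq_bigr => t _; rewrite lrow_nth // !mxE.
Qed.

Lemma row_mul_entry p q N (A : 'M[R]_(p, size N)) (Z : 'M[R]_(size N, q)) i : uniq N ->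
  row i (A *m Z) = \sum_(x <- N) entry A i x *: lrow Z x.
Proof.
move=> uN; rewrite -row_mul_lrow //; congr (row i (_ *m _)).
by apply/matrixP => j t; rewrite mxE entry_nth.
Qed.

Lemma lrow_mul p q N (Z : 'M[R]_(size N, p)) (T : 'M[R]_(p, q)) x :
  lrow (Z *m T) x = lrow Z x *m T.
Proof. by rewrite /lrow; case: insub => [t|] /=; rewrite ?row_mul ?mul0mx. Qed.

Lemma lrow_rows q N (h : nat -> 'rV[R]_q) x : uniq N -> x \in N ->
  lrow (\matrix_(t < size N) h (nth 0%N N t)) x = h x.
Proof. by move=> uN /mem_nthP[t ->]; rewrite lrow_nth // rowK. Qed.

Lemma index_set_filter N (P : pred nat) : index_set N -> index_set (seq.filter P N).
Proof. by apply: subseq_path; [exact: ltn_trans|exact: filter_subseq]. Qed.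

Lemma filter_positions N (P : pred nat) : index_set N ->
  exists2 phi : 'I_(size (seq.filter P N)) -> 'I_(size N),
    increasing phi & forall t, nth 0%N N (phi t) = nth 0%N (seq.filter P N) t.
Proof.
move=> Nset.
have idx (t : 'I_(size (seq.filter P N))) : (index (nth 0%N (seq.filter P N) t) N < size N)%N.
  by rewrite index_mem (mem_subseq (filter_subseq P N)) // mem_nth.
have nthE t : nth 0%N N (Ordinal (idx t)) = nth 0%N (seq.filter P N) t.
  by rewrite /= nth_index // (mem_subseq (filter_subseq P N)) // mem_nth.
exists (fun t => Ordinal (idx t)) => // i j ij.
by rewrite -(nth_lt Nset) !nthE nth_lt // index_set_filter.
Qed.

(** The cell provides a representative with nonnegative minors, while coindependence provides a
    nonzero minor of possibly another one. A change of representative multiplies all maximal minors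
    by the same nonzero determinant. *)
Lemma coindependent_minor k N J (S : set (Gr R k (size N))) V A :
  positroid_cell S -> coindependent J S -> S V -> represents V A ->
  exists g A', [/\ A' = g *m A, nonneg_minors A' & exists2 I : 'I_k -> 'I_(size N),
    increasing I & \det (colsub I A') != 0 /\ forall i, nth 0%N N (I i) \notin J].
Proof.
move=> [_ [M SE]] Scoind SV VA.
have [A' [VA' A'0 _]] : exists A', [/\ represents V A', nonneg_minors A' &
    forall I, increasing I -> (\det (colsub I A') != 0 <-> M I)].
  by move: SV; rewrite {1}SE.
have [A2 [VA2 [I [Iincr A2I IJ]]]] := Scoind _ SV.
have [g gu A'E] := represents_eq VA VA'; have [h hu A'h] := represents_eq VA2 VA'.
exists g, A'; split=> //; exists I => //; split=> //.
rewrite A'h -mulmx_colsub det_mulmx mulf_neq0 //.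
by move: hu; rewrite unitmxE unitfE.
Qed.
End LabelledSums.

Lemma addmx_sub_cancel (F : fieldType) m p q (U V : 'M[F]_(m, q)) (W : 'M[F]_(p, q)) :
  ((U + V)%R <= W)%MS -> (V <= W)%MS -> (U <= W)%MS.
Proof. by move=> UV VW; rewrite -(addrK V U); apply: addmx_sub; rewrite ?eqmx_opp. Qed.

(** * Positions of labels in the BCFW product *)

Section BCFWIndices.
Variables (N : seq nat) (a b c d n : nat).
Hypothesis Nbcfw : bcfw_indices N a b c d n.

Lemma bcfw_mem : [/\ a \in N, b \in N, c \in N, d \in N & n \in N].
Proof. by case: Nbcfw => -[nN _] [aN bN _ _] _ [cN dN _ _] _. Qed.

Lemma bcfw_lt : [/\ a < b, b < c, c < d & d < n]%N.
Proof. by case: Nbcfw => _ [_ _ ? _] ? [_ _ ? _] [_ _ ? _]. Qed.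

Variant bcfw_spec x : Prop :=
  | BcfwLow of (x < a)%N
  | BcfwA of x = a
  | BcfwB of x = b
  | BcfwMid of (b < x < c)%N
  | BcfwC of x = c
  | BcfwD of x = d
  | BcfwN of x = n.

Lemma bcfwP x : x \in N -> bcfw_spec x.
Proof.
move=> xN; case: Nbcfw => -[_ Nmax] [_ _ ab Hab] bc [_ _ cd Hcd] [_ _ dn Hdn].
have := Nmax _ xN; have := Hab _ xN; have := Hcd _ xN; have := Hdn _ xN.
move=> H1 H2 H3 H4; clear -ab bc cd dn H1 H2 H3 H4.
case: (ltngtP x a) => Ha; [exact: BcfwLow| |exact: BcfwA].
case: (ltngtP x b) => Hb; [lia| |exact: BcfwB].
case: (ltngtP x c) => Hc; [by apply: BcfwMid; rewrite Hb| |exact: BcfwC].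
case: (ltngtP x d) => Hd; [lia| |exact: BcfwD].
by apply: BcfwN; lia.
Qed.
End BCFWIndices.

Ltac decide_labels := repeat match goal with
  | |- context [if ?e then _ else _] =>
      first [have -> : e = true by lia | have -> : e = false by lia]
  end.

(** * Regrouping the rows of a BCFW matrix *)

Section BCFWTerms.
Context {R : realType} {V : lmodType R}.
Variables (N : seq nat) (a b c d n : nat).
Hypothesis Nbcfw : bcfw_indices N a b c d n.
Variables (e : nat -> R) (z : nat -> V).

(** The multiple of [z a] that column a receives from entry b is moved to label b, where it turns
    [z b] into the promoted vector. The last two summands record this move and cancel in the sum
    over [N]. *)
Lemma left_row_terms (r s : R) x : x \in N ->
  (if (x < a)%N then e x else if x == a then e a + r * e b
   else if x == b then e b else if x == n then s * e n else 0) *: z x =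
  (if [|| (x <= a)%N, x == b | x == n] then
     e x *: ((if x == n then s else 1) *: (if x == b then z b + r *: z a else z x))
   else 0) + (if x == a then (r * e b) *: z a else 0)
           - (if x == b then (r * e b) *: z a else 0).
Proof.
move=> xN; have [ab bc cd dn] := bcfw_lt Nbcfw.
case: (bcfwP Nbcfw xN) => [xa|->|->|xbc|->|->|->]; decide_labels;
  rewrite ?scale0r ?scale1r ?addr0 ?subr0 //.
- by rewrite scalerDl.
- by rewrite scalerDr scalerA [e b * r]mulrC addrK.
- by rewrite scalerA mulrC.
Qed.

(** This form serves the span argument: apart from labels below a, only multiples of [z a], [z b]
    and [z n] appear. *)
Lemma left_row_split (r s : R) x : x \in N ->
  (if (x < a)%N then e x else if x == a then e a + r * e b
   else if x == b then e b else if x == n then s * e n else 0) *: z x =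
  (if [|| (x <= a)%N, x == b | x == n] then (if (x < a)%N then e x else 0) *: z x else 0)
  + (if x == a then (e a + r * e b) *: z a else 0)
  + (if x == b then e b *: z b else 0)
  + (if x == n then (s * e n) *: z n else 0).
Proof.
move=> xN; have [ab bc cd dn] := bcfw_lt Nbcfw.
by case: (bcfwP Nbcfw xN) => [xa|->|->|xbc|->|->|->]; decide_labels;
  rewrite ?scale0r ?scale1r ?addr0 ?add0r //.
Qed.

Lemma mid_row_terms (al be ga de ep : R) x : x \in N ->
  (if x == a then al else if x == b then be else if x == c then ga
   else if x == d then de else if x == n then ep else 0) *: z x =
  (if x == a then al *: z a else 0) + (if x == b then be *: z b else 0)
  + (if x == c then ga *: z c else 0) + (if x == d then de *: z d else 0)
  + (if x == n then ep *: z n else 0).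
Proof.
move=> xN; have [ab bc cd dn] := bcfw_lt Nbcfw.
by case: (bcfwP Nbcfw xN) => [xa|->|->|xbc|->|->|->]; decide_labels;
  rewrite ?scale0r ?addr0 ?add0r.
Qed.

(** The multiples that columns c and d receive from entries d and n are moved back to those labels,
    completing [z d] and [z n] to promoted vectors. The last three summands cancel in the sum over
    [N]. *)
Lemma right_row_terms (r s : R) x : x \in N ->
  (if (x < b)%N then 0 else if (x < c)%N then e x
   else if x == c then e c + r * (e d + s * e n)
   else if x == d then e d + s * e n else e n) *: z x =
  (if (b <= x <= d)%N || (x == n) then
     e x *: (if x == n then z n + s *: z d + (r * s) *: z c
             else if x == d then z d + r *: z c else z x)
   else 0)
  + (if x == c then (r * (e d + s * e n)) *: z c else 0)
  + (if x == d then (s * e n) *: z d - (r * e d) *: z c else 0)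
  - (if x == n then (s * e n) *: z d + (r * s * e n) *: z c else 0).
Proof.
move=> xN; have [ab bc cd dn] := bcfw_lt Nbcfw.
case: (bcfwP Nbcfw xN) => [xa|->|->|xbc|->|->|->]; decide_labels;
  rewrite ?scale0r ?addr0 ?subr0 //.
- by rewrite scalerDl.
- rewrite scalerDl scalerDr scalerA [e d * r]mulrC -!addrA; congr (_ + _).
  by rewrite addrCA subrr addr0.
- rewrite !scalerDr !scalerA ![e n * _]mulrC.
  by rewrite -[X in _ = X - _]addrA addrK.
Qed.

Lemma right_row_split (r s : R) x : x \in N ->
  (if (x < b)%N then 0 else if (x < c)%N then e x
   else if x == c then e c + r * (e d + s * e n)
   else if x == d then e d + s * e n else e n) *: z x =
  (if (b <= x <= d)%N || (x == n) then (if (b < x < c)%N then e x else 0) *: z x else 0)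
  + (if x == b then e b *: z b else 0)
  + (if x == c then (e c + r * (e d + s * e n)) *: z c else 0)
  + (if x == d then (e d + s * e n) *: z d else 0)
  + (if x == n then e n *: z n else 0).
Proof.
move=> xN; have [ab bc cd dn] := bcfw_lt Nbcfw.
by case: (bcfwP Nbcfw xN) => [xa|->|->|xbc|->|->|->]; decide_labels;
  rewrite ?scale0r ?addr0 ?add0r.
Qed.
End BCFWTerms.

(** * The image of a BCFW matrix *)

Section BCFW.
Context {R : realType}.
Variables (N : seq nat) (a b c d n kL kR : nat).
Hypotheses (Nset : index_set N) (Nbcfw : bcfw_indices N a b c d n).
Let NL := N_left N a b n.
Let NR := N_right N b d n.
Variables (A : 'M[R]_(kL, size NL)) (B : 'M[R]_(kR, size NR)) (al be ga de ep : R).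
Hypotheses (al0 : 0 < al) (be0 : 0 < be) (ga0 : 0 < ga) (de0 : 0 < de) (ep0 : 0 < ep).
Variable Z : 'M[R]_(size N, kL + 1 + kR + 4).
Let z := lrow Z.
Let C := bcfw_mx c A al be ga de ep B.

Let uN : uniq N. Proof. exact: index_set_uniq. Qed.
Let uNL : uniq NL. Proof. by apply/index_set_uniq/index_set_filter. Qed.
Let uNR : uniq NR. Proof. by apply/index_set_uniq/index_set_filter. Qed.

Let aN : a \in N. Proof. by case: (bcfw_mem Nbcfw). Qed.
Let bN : b \in N. Proof. by case: (bcfw_mem Nbcfw). Qed.
Let cN : c \in N. Proof. by case: (bcfw_mem Nbcfw). Qed.
Let dN : d \in N. Proof. by case: (bcfw_mem Nbcfw). Qed.
Let nN : n \in N. Proof. by case: (bcfw_mem Nbcfw). Qed.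

Let sL : R := (-1) ^+ kR.+1.
Let sR : R := (-1) ^+ kR.

Definition left_row (i : 'I_kL) x : R :=
  if (x < a)%N then entry A i x
  else if x == a then entry A i a + al / be * entry A i b
  else if x == b then entry A i b
  else if x == n then sL * entry A i n else 0.

Definition mid_row (i : 'I_1) x : R :=
  if x == a then al else if x == b then be else if x == c then sR * ga
  else if x == d then sR * de else if x == n then sR * ep else 0.

Definition right_row (i : 'I_kR) x : R :=
  if (x < b)%N then 0 else if (x < c)%N then entry B i x
  else if x == c then entry B i c + ga / de * (entry B i d + de / ep * entry B i n)
  else if x == d then entry B i d + de / ep * entry B i n
  else entry B i n.

Let L := (\matrix_(i < kL, t < size N) left_row i (nth 0%N N t)) *m Z.
Let M := (\matrix_(i < 1, t < size N) mid_row i (nth 0%N N t)) *m Z.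
Let Rr := (\matrix_(i < kR, t < size N) right_row i (nth 0%N N t)) *m Z.

Lemma bcfw_mulE : C *m Z = col_mx (col_mx L M) Rr.
Proof. by rewrite /C /bcfw_mx !mul_col_mx. Qed.

Lemma mid_rowE : M = al *: z a + be *: z b + (sR * ga) *: z c + (sR * de) *: z d
  + (sR * ep) *: z n.
Proof.
apply/row_matrixP => i; rewrite row_mul_lrow // !(ord1 i) row_id.
under eq_big_seq => x xN do rewrite (mid_row_terms Nbcfw z) //.
by rewrite !big_split /= !sum_pick.
Qed.

(** These are the promoted vectors with the ratio of twistor coordinates replaced by its value at
    the image point; see [subst_leftE]. *)
Definition zL x := if x == b then z b + (al / be) *: z a else z x.
(** The sign in the row of n is that of column n of the left block; purity of the functionary
    removes it again in [left_eval]. *)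
Definition ZL := \matrix_(t < size NL)
  ((if nth 0%N NL t == n then sL else 1) *: zL (nth 0%N NL t)).

Lemma left_rowsE : L = A *m ZL.
Proof.
apply/row_matrixP => i; rewrite row_mul_lrow // row_mul_entry //.
under eq_big_seq => x xN do rewrite (left_row_terms Nbcfw (entry A i) z) //.
rewrite !big_split /= sumrN !sum_pick // addrK -big_mkcond -big_filter.
apply: eq_big_seq => x xNL.
by rewrite (lrow_rows (fun x => (if x == n then sL else 1) *: zL x)).
Qed.

Definition zR x :=
  if x == n then z n + (de / ep) *: z d + (ga / de * (de / ep)) *: z c
  else if x == d then z d + (ga / de) *: z c else z x.
Definition ZR := \matrix_(t < size NR) zR (nth 0%N NR t).

Lemma right_rowsE : Rr = B *m ZR.
Proof.
apply/row_matrixP => i; rewrite row_mul_lrow // row_mul_entry //.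
under eq_big_seq => x xN do rewrite (right_row_terms Nbcfw (entry B i) z) //.
rewrite !big_split /= sumrN !sum_pick // -big_mkcond -big_filter.
(* [P + Q], [D - P] and [D + Q] are the corrections at the labels c, d and n. *)
have cancel (P Q D : 'rV[R]_(kL + 1 + kR + 4)) (S : 'rV[R]_(kL + 1 + kR + 4)) :
    S + (P + Q) + (D - P) - (D + Q) = S.
  by rewrite [P + Q]addrC [D - P]addrC -!addrA addNKr
    [Q + _]addrA [Q + D]addrC subrr addr0.
rewrite mulrDr scalerDl -[ga / de * (de / ep) * _]mulrA cancel.
by apply: eq_big_seq => x xNR; rewrite lrow_rows.
Qed.

Let tw x y u w := twistor (C *m Z) z [tuple x; y; u; w].

(** The middle row lies in Y, so a twistor coordinate with this row in its first slot vanishes; the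
    claim follows by linearity. *)
Lemma mid_relation x y w :
  al * tw a x y w + be * tw b x y w + sR * ga * tw c x y w + sR * de * tw d x y w
  + sR * ep * tw n x y w = 0.
Proof.
have [phi [twE Cphi]] := twistor_linear (C *m Z) z x y w.
rewrite /tw !twE.
have : M *m phi = 0.
  by move: Cphi; rewrite bcfw_mulE !mul_col_mx => /(congr1 usubmx); rewrite col_mxKu
    => /(congr1 dsubmx); rewrite col_mxKd !linear0.
move=> /matrixP/(_ 0 0); rewrite mid_rowE !mulmxDl -!scalemxAl !mxE.
by [].
Qed.

Let tw_rep01 x y w : tw x x y w = 0. Proof. exact: twistor_repeat. Qed.

Let tw_rep02 x y w : tw x y x w = 0.
Proof. by rewrite /tw twistor_swap12 -/(tw _ _ _ _) tw_rep01 oppr0. Qed.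

Let tw_rep03 x y w : tw x y w x = 0.
Proof. by rewrite /tw twistor_swap23 -/(tw _ _ _ _) tw_rep02 oppr0. Qed.

Let be_neq0 : be != 0. Proof. exact: lt0r_neq0. Qed.
Let ep_neq0 : ep != 0. Proof. exact: lt0r_neq0. Qed.
Let de_neq0 : de != 0. Proof. exact: lt0r_neq0. Qed.
Let sR_neq0 : sR != 0. Proof. by rewrite signr_eq0. Qed.

(** With three of the five labels a, b, c, d, n in the last slots, [mid_relation] keeps only two
    terms. This and the next three lemmas use it for different triples. *)
Lemma tw_bcdn : be * tw b c d n = - (al * tw a c d n).
Proof.
have := mid_relation c d n; rewrite tw_rep01 tw_rep02 tw_rep03 !mulr0 !addr0.
by move/eqP; rewrite addr_eq0 => /eqP ->; rewrite opprK.
Qed.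

Lemma tw_abcn : ep * tw a b c n = - (de * tw a b c d).
Proof.
have := mid_relation a b c; rewrite tw_rep01 tw_rep02 tw_rep03 !mulr0 !add0r.
rewrite -!mulrA -mulrDr => /eqP; rewrite mulf_eq0 (negbTE sR_neq0) /=.
have rot x : tw x a b c = - tw a b c x.
  by rewrite /tw twistor_swap01 twistor_swap12 twistor_swap23 !opprK.
by rewrite !rot !mulrN -opprD oppr_eq0 addr_eq0 => /eqP ->; rewrite opprK.
Qed.

Lemma tw_abdn : ep * tw a b d n = ga * tw a b c d.
Proof.
have := mid_relation a b d; rewrite tw_rep01 tw_rep02 tw_rep03 !mulr0 !add0r addr0.
rewrite -!mulrA -mulrDr => /eqP; rewrite mulf_eq0 (negbTE sR_neq0) /=.
have -> : tw n a b d = - tw a b d n.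
  by rewrite /tw twistor_swap01 twistor_swap12 twistor_swap23 !opprK.
have -> : tw c a b d = tw a b c d.
  by rewrite /tw twistor_swap01 twistor_swap12 opprK.
by rewrite mulrN subr_eq0 => /eqP.
Qed.

Lemma tw_abcd : sR * ep * tw a c d n = - (be * tw a b c d).
Proof.
have := mid_relation a c d; rewrite tw_rep01 tw_rep02 tw_rep03 !mulr0 !add0r !addr0.
have -> : tw n a c d = - tw a c d n.
  by rewrite /tw twistor_swap01 twistor_swap12 twistor_swap23 !opprK.
have -> : tw b a c d = - tw a b c d by rewrite /tw twistor_swap01.
by rewrite !mulrN -opprD => /eqP; rewrite oppr_eq0 addr_eq0 => /eqP ->; rewrite opprK.
Qed.

(** The determinant of this matrix is <<acdn>>; it is shown to be nonzero by exhibiting enough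
    vectors in the row space. *)
Let X := col_mx (C *m Z) (\matrix_(r < 4) z (tnth [tuple a; c; d; n] r)).

Lemma C_sub : (C *m Z <= X)%MS.
Proof. by rewrite /X -addsmxE addsmxSl. Qed.

Lemma left_sub : (L <= X)%MS.
Proof.
apply: submx_trans C_sub; rewrite bcfw_mulE -addsmxE.
by apply: submx_trans (addsmxSl _ _); rewrite -addsmxE addsmxSl.
Qed.

Lemma mid_sub : (M <= X)%MS.
Proof.
apply: submx_trans C_sub; rewrite bcfw_mulE -addsmxE.
by apply: submx_trans (addsmxSl _ _); rewrite -addsmxE addsmxSr.
Qed.

Lemma right_sub : (Rr <= X)%MS.
Proof. by apply: submx_trans C_sub; rewrite bcfw_mulE -addsmxE addsmxSr. Qed.

Lemma tuple_sub x : x \in [:: a; c; d; n] -> (z x <= X)%MS.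
Proof.
move=> /(tnthP [tuple a; c; d; n])[r ->].
rewrite /X -addsmxE; apply: submx_trans (addsmxSr _ _).
by rewrite -(rowK (fun r => z (tnth [tuple a; c; d; n] r)) r) row_sub.
Qed.

(** The middle row can be solved for [z b], as its coefficient [be] is nonzero and the other four
    vectors are rows of [X]. *)
Lemma zb_sub : (z b <= X)%MS.
Proof.
have sub x t : x \in [:: a; c; d; n] -> (t *: z x <= X)%MS.
  by move=> /tuple_sub; apply: scalemx_sub.
have : (be *: z b <= X)%MS.
  apply: (addmx_sub_cancel (V := al *: z a + ((sR * ga) *: z c + ((sR * de) *: z d
    + (sR * ep) *: z n)))).
    by move: mid_sub; rewrite mid_rowE [al *: _ + be *: _]addrC -!addrA.
  by do 3 (apply: addmx_sub; first by apply: sub; rewrite !inE eqxx ?orbT);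
    apply: sub; rewrite !inE eqxx ?orbT.
by rewrite eqmx_scale.
Qed.

Lemma scaled_sub x t : x \in [:: a; b; c; d; n] -> (t *: z x <= X)%MS.
Proof.
move=> xin; apply: scalemx_sub; have [->|xb] := eqVneq x b; first exact: zb_sub.
by apply: tuple_sub; move: xin; rewrite !inE (negbTE xb).
Qed.

(** These are the parts of the left and right rows that remain modulo the vectors labelled a, b, c,
    d, n, all of which lie in the row space of [X]. *)
Definition left_trunc i x : R := if (x < a)%N then entry A i x else 0.
Definition right_trunc i x : R := if (b < x < c)%N then entry B i x else 0.

Lemma trunc_lrow m (P : pred nat) (e : 'I_m -> nat -> R)
    (phi : 'I_(size (seq.filter P N)) -> 'I_(size N)) i :
  (forall t, nth 0%N N (phi t) = nth 0%N (seq.filter P N) t) ->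
  row i ((\matrix_(i < m, t < _) e i (nth 0%N (seq.filter P N) t)) *m rowsub phi Z) =
  \sum_(x <- N) if P x then e i x *: z x else 0.
Proof.
move=> phiE; have uP : uniq (seq.filter P N) by apply: filter_uniq.
rewrite row_mul_lrow // -big_mkcond -big_filter; apply: eq_big_seq => x.
move=> /mem_nthP[t ->]; rewrite lrow_nth // -phiE /z lrow_nth //.
by congr (_ *: _); apply/rowP => j; rewrite !mxE.
Qed.

Lemma left_trunc_sub (phi : 'I_(size NL) -> 'I_(size N)) :
  (forall t, nth 0%N N (phi t) = nth 0%N NL t) ->
  ((\matrix_(i < kL, t < size NL) left_trunc i (nth 0%N NL t)) *m rowsub phi Z <= X)%MS.
Proof.
move=> phiE; apply/row_subP => i; rewrite trunc_lrow //.
have : (row i L <= X)%MS by apply: submx_trans (row_sub i L) left_sub.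
rewrite row_mul_lrow //.
under eq_big_seq => x xN do rewrite (left_row_split Nbcfw (entry A i) z) //.
rewrite !big_split /= !sum_pick // => LX.
by apply: (addmx_sub_cancel (addmx_sub_cancel (addmx_sub_cancel LX _) _) _);
  rewrite scaled_sub // !inE eqxx ?orbT.
Qed.

Lemma right_trunc_sub (psi : 'I_(size NR) -> 'I_(size N)) :
  (forall t, nth 0%N N (psi t) = nth 0%N NR t) ->
  ((\matrix_(i < kR, t < size NR) right_trunc i (nth 0%N NR t)) *m rowsub psi Z <= X)%MS.
Proof.
move=> psiE; apply/row_subP => i; rewrite trunc_lrow //.
have : (row i Rr <= X)%MS by apply: submx_trans (row_sub i Rr) right_sub.
rewrite row_mul_lrow //.
under eq_big_seq => x xN do rewrite (right_row_split Nbcfw (entry B i) z) //.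
rewrite !big_split /= !sum_pick // => RX.
by apply: (addmx_sub_cancel (addmx_sub_cancel (addmx_sub_cancel (addmx_sub_cancel RX _) _) _) _);
  rewrite scaled_sub // !inE eqxx ?orbT.
Qed.

(** The row space of [X] contains the five labelled vectors and the truncated rows of [A'] and [B']
    applied to [Z]. These are kL + 2 + kR + 3 vectors, as many as the dimension, and by
    [interleaved_row_full] they span the whole space. *)
Lemma tw_acdn_neq0 : Mat_pos Z ->
  (exists g A', [/\ A' = g *m A, nonneg_minors A' & exists2 I : 'I_kL -> 'I_(size NL),
    increasing I & \det (colsub I A') != 0 /\
      forall i, nth 0%N NL (I i) \notin [:: a; b; n]]) ->
  (exists g B', [/\ B' = g *m B, nonneg_minors B' & exists2 I : 'I_kR -> 'I_(size NR),
    increasing I & \det (colsub I B') != 0 /\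
      forall i, nth 0%N NR (I i) \notin [:: b; c; d; n]]) ->
  tw a c d n != 0.
Proof.
move=> Zpos [g [A' [A'E A'0 [IA IAincr [A'IA IAlab]]]]] [h [B' [B'E B'0 [IB IBincr [B'IB IBlab]]]]].
have [ab bc cd dn] := bcfw_lt Nbcfw.
have [phi phii phiE] := filter_positions [pred x | [|| (x <= a)%N, x == b | x == n]] Nset.
have [psi psii psiE] := filter_positions [pred x | (b <= x <= d)%N || (x == n)] Nset.
have [[pa paE] [pb pbE] [pc pcE] [pd pdE] [pn pnE]] :
    [/\ exists p : 'I_(size N), a = nth 0%N N p, exists p : 'I_(size N), b = nth 0%N N p,
        exists p : 'I_(size N), c = nth 0%N N p, exists p : 'I_(size N), d = nth 0%N N p &
        exists p : 'I_(size N), n = nth 0%N N p].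
  by split; apply: mem_nthP.
pose pab (i : 'I_2) := if i == 0%N :> nat then pa else pb.
pose pcdn (i : 'I_3) := if i == 0%N :> nat then pc else if i == 1%N :> nat then pd else pn.
have pabE i : nth 0%N N (pab i) = if i == 0%N :> nat then a else b.
  by rewrite /pab; case: ifP; rewrite -?paE -?pbE.
have pcdnE i : nth 0%N N (pcdn i) = if i == 0%N :> nat then c else if i == 1%N :> nat then d else n.
  by rewrite /pcdn; case: ifP; [|case: ifP]; rewrite -?pcE -?pdE -?pnE.
(* A minor of a truncated matrix is either the original minor or zero, so nonnegativity persists.
   The minors on [IA] and [IB] survive: labels avoiding a, b, n lie below a, and labels avoiding b,
   c, d, n lie between b and c. *)
pose A2 : 'M[R]_(kL, size NL) := \matrix_(i, t) if (nth 0%N NL t < a)%N then A' i t else 0.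
pose B2 : 'M[R]_(kR, size NR) := \matrix_(i, t) if (b < nth 0%N NR t < c)%N then B' i t else 0.
have A2minor f : \det (colsub f A2) =
    if [forall i, nth 0%N NL (f i) < a]%N then \det (colsub f A') else 0.
  exact: (det_truncated_minor _ (fun t => nth 0%N NL t < a)%N).
have B2minor f : \det (colsub f B2) =
    if [forall i, b < nth 0%N NR (f i) < c]%N then \det (colsub f B') else 0.
  exact: (det_truncated_minor _ (fun t => b < nth 0%N NR t < c)%N).
have full : row_full (col_mx (col_mx (col_mx (A2 *m rowsub phi Z) (rowsub pab Z))
    (B2 *m rowsub psi Z)) (rowsub pcdn Z)).
  apply: interleaved_row_full => //.
  - by rewrite -!addnA (addnS kR 3).
  - by move=> i j; rewrite -(nth_lt Nset) !pabE; case: i j => [[|[|i]] Hi] [[|[|j]] Hj].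
  - move=> i j; rewrite -(nth_lt Nset) !pcdnE.
    by case: i j => [[|[|[|i]]] Hi] [[|[|[|j]]] Hj] // _; apply: ltn_trans cd dn.
  - move=> i j; rewrite -(nth_lt Nset) pabE pcdnE.
    have ac := ltn_trans ab bc; have bd := ltn_trans bc cd; have ad := ltn_trans ab bd.
    case: ifP => _; case: ifP => // _; case: ifP => // _; exact: ltn_trans dn.
  - by move=> f fi; rewrite A2minor; case: ifP => // _; apply: A'0.
  - exists IA => //; rewrite A2minor; case: forallP => // -[] i.
    have := IAlab i; have := mem_nth 0%N (ltn_ord (IA i)).
    rewrite mem_filter !inE !negb_or => /andP[/or3P[xa|/eqP ->|/eqP ->] _] /and3P[na nb nn].
    + by rewrite ltn_neqAle na.
    + by rewrite eqxx in nb.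
    + by rewrite eqxx in nn.
  - by move=> f fi; rewrite B2minor; case: ifP => // _; apply: B'0.
  - exists IB => //; rewrite B2minor; case: forallP => // -[] i.
    have := IBlab i; have xN := mem_nth 0%N (ltn_ord (IB i)); move: (xN).
    rewrite mem_filter !inE !negb_or => /andP[xR xN'] /and4P[nb nc nd nn].
    case: (bcfwP Nbcfw xN') => // [xa|xa|e|e|e|e].
    + move: xR; rewrite (negbTE nn) orbF leqNgt => /andP[].
      by rewrite (ltn_trans xa ab).
    + by move: xR; rewrite (negbTE nn) orbF leqNgt => /andP[]; rewrite xa ab.
    + by rewrite e eqxx in nb.
    + by rewrite e eqxx in nc.
    + by rewrite e eqxx in nd.
    + by rewrite e eqxx in nn.
  - move=> f; rewrite A2minor; case: forallP => [fa _ i j|]; last by rewrite eqxx.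
    rewrite -(nth_lt Nset) pabE phiE; case: ifP => // _.
    exact: ltn_trans (fa i) ab.
  - move=> f; rewrite B2minor; case: forallP => [fb _ i j|]; last by rewrite eqxx.
    rewrite -(nth_lt Nset) pabE psiE; have /andP[bx _] := fb i; case: ifP => // _.
    exact: ltn_trans ab bx.
  - move=> f; rewrite B2minor; case: forallP => [fb _ i j|]; last by rewrite eqxx.
    rewrite -(nth_lt Nset) pcdnE psiE; have /andP[_ xc] := fb i; case: ifP => // _.
    case: ifP => // _; first exact: ltn_trans xc cd.
    exact: ltn_trans xc (ltn_trans cd dn).
have sub_row (p : 'I_(size N)) : nth 0%N N p \in [:: a; b; c; d; n] -> (row p Z <= X)%MS.
  by move=> pN; rewrite -lrow_nth // -[lrow _ _]scale1r scaled_sub.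
rewrite /tw /twistor det_eq0_row_free row_free_unit -row_full_unit.
rewrite -sub1mx; apply: (submx_trans (_ : 1%:M <= _)%MS); first by rewrite sub1mx; exact: full.
rewrite !col_mx_sub -/X; do ?[apply/andP; split].
- have -> : A2 = g *m (\matrix_(i < kL, t < size NL) left_trunc i (nth 0%N NL t)).
    apply/matrixP => i t; rewrite !mxE A'E; case: ifP => xa.
      rewrite mxE; apply: eq_bigr => l _; rewrite mxE /left_trunc xa entry_nth //.
    by rewrite big1 // => l _; rewrite mxE /left_trunc xa mulr0.
  by rewrite -mulmxA mulmx_sub // left_trunc_sub.
- apply/row_subP => i; rewrite row_rowsub; apply: sub_row; rewrite pabE.
  by case: ifP; rewrite !inE eqxx ?orbT.
- have -> : B2 = h *m (\matrix_(i < kR, t < size NR) right_trunc i (nth 0%N NR t)).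
    apply/matrixP => i t; rewrite !mxE B'E; case: ifP => xa.
      rewrite mxE; apply: eq_bigr => l _; rewrite mxE /right_trunc xa entry_nth //.
    by rewrite big1 // => l _; rewrite mxE /right_trunc xa mulr0.
  by rewrite -mulmxA mulmx_sub // right_trunc_sub.
- apply/row_subP => i; rewrite row_rowsub; apply: sub_row; rewrite pcdnE.
  by case: ifP; [|case: ifP]; rewrite !inE eqxx ?orbT.
Qed.

(** * Values of promoted functionaries on the image *)

Section Evaluation.
Hypothesis acdn0 : tw a c d n != 0.
Variable g : 'M[R]_(kL + 1 + kR).
Hypothesis gu : g \in unitmx.

Let detg0 : \det g != 0. Proof. by move: gu; rewrite unitmxE unitfE. Qed.

Lemma tw_ratio I J : twistor (g *m (C *m Z)) z I / twistor (g *m (C *m Z)) z J =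
  twistor (C *m Z) z I / twistor (C *m Z) z J.
Proof. by rewrite !twistor_mull -mulf_div divff // mul1r. Qed.

Lemma tw_abcd_neq0 : tw a b c d != 0.
Proof.
apply/eqP => abcd0; have := tw_abcd; rewrite abcd0 mulr0 oppr0 => /eqP.
by rewrite !mulf_eq0 (negbTE sR_neq0) (negbTE ep_neq0) (negbTE acdn0).
Qed.

Lemma tw_abcn_neq0 : tw a b c n != 0.
Proof.
apply/eqP => abcn0; have := tw_abcn; rewrite abcn0 mulr0 => /esym/eqP.
by rewrite oppr_eq0 mulf_eq0 (negbTE de_neq0) (negbTE tw_abcd_neq0).
Qed.

Lemma subst_leftE x : subst_left a b c d n (g *m (C *m Z)) z x = zL x.
Proof.
rewrite /subst_left tw_ratio -/(tw _ _ _ _) -/(tw _ _ _ _) /zL.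
have -> : tw b c d n / tw a c d n = - (al / be).
  apply: (mulfI be_neq0); rewrite mulrA tw_bcdn mulNr mulfK // mulrN mulrCA mulfV //.
  by rewrite mulr1.
by rewrite scaleNr opprK.
Qed.

Lemma subst_rightE x : subst_right a b c d n (g *m (C *m Z)) z x = zR x.
Proof.
rewrite /subst_right !tw_ratio -!/(tw _ _ _ _) /zR.
have abcd0 := tw_abcd_neq0; have abcn0 := tw_abcn_neq0.
have -> : tw a b c n / tw a b c d = - (de / ep).
  apply: (mulfI ep_neq0); rewrite mulrA tw_abcn mulNr mulfK // mulrN mulrCA mulfV //.
  by rewrite mulr1.
have -> : tw a b d n / tw a b c d = ga / de * (de / ep).
  rewrite mulrA divfK //; apply: (mulfI ep_neq0).
  by rewrite mulrA tw_abdn mulfK // mulrCA mulfV // mulr1.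
have -> : tw a b d n / tw a b c n = - (ga / de).
  apply: (mulIf abcn0); rewrite divfK //; apply: (mulfI ep_neq0).
  rewrite tw_abdn mulrCA tw_abcn mulrNN mulrA divfK //.
by rewrite !scaleNr !opprK.
Qed.

(** With the rows [M] and [Rr] fixed, [det_fixed_rows] turns the promoted coordinates into a
    constant times those of [A *m (ZL *m T)] in dimension kL + 4. The sign [sL] at label n is
    extracted by [tweval_scale]. As [ZL *m T] may fail to be positive, the vanishing is assumed for
    every [Z']. *)
Lemma left_eval F : functionary NL F -> pure F ->
  (forall Z' : 'M[R]_(size NL, kL + 4), tweval (twistor (A *m Z') (lrow Z')) F = 0) ->
  tweval (twistor (g *m (C *m Z)) (subst_left a b c d n (g *m (C *m Z)) z)) F = 0.
Proof.
move=> FN pF F0; have [e [f FE]] := tweval_scale n FN pF.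
(* [P] is the block permutation that recovers the original order of rows from the one in which the
   four substituted vectors follow [L]. *)
pose P : 'M[R]_(kL + 1 + kR + 4, (kL + 4) + (1 + kR)) :=
  col_mx (col_mx (col_mx (row_mx (row_mx 1%:M 0) 0) (row_mx 0 (row_mx 1%:M 0)))
    (row_mx 0 (row_mx 0 1%:M))) (row_mx (row_mx 0 1%:M) 0).
have [|ka [T PT]] := det_fixed_rows P (col_mx M Rr).
  by rewrite -!addnA; congr (_ + _)%N; rewrite addnA addnC.
rewrite (FE _ (twistor (A *m (ZL *m T)) (lrow (ZL *m T))) (\det g * ka) sL) ?F0 ?mulr0 //.
move=> I _ /allP IN; rewrite twistor_mull -!mulrA; congr (_ * _).
have -> : twistor (C *m Z) (subst_left a b c d n (g *m (C *m Z)) z) I =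
    ka * twistor (A *m (ZL *m T)) (fun x => (if x == n then sL else 1) *: lrow (ZL *m T) x) I.
  rewrite /twistor; set W := (\matrix_r subst_left _ _ _ _ _ _ _ _); rewrite bcfw_mulE.
  have -> : col_mx (col_mx (col_mx L M) Rr) W = P *m col_mx (col_mx L W) (col_mx M Rr).
    by rewrite !mul_col_mx !mul_row_col !mul1mx !mul0mx !addr0 !add0r.
  rewrite PT mul_col_mx; congr (_ * \det (col_mx _ _)).
    by rewrite left_rowsE mulmxA.
  apply/row_matrixP => r; rewrite row_mul !rowK subst_leftE lrow_mul.
  rewrite (lrow_rows (fun x => (if x == n then sL else 1) *: zL x)) //; last first.
    by apply: IN; apply: mem_tnth.
  rewrite scalemxAl scalerA; case: ifP => _; last by rewrite mulr1 scale1r.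
  by rewrite -expr2 sqrr_sign scale1r.
rewrite twistor_scale; congr (_ * (_ * _)).
by rewrite -big_mkcond /= big_const_seq iter_mulr_1.
Qed.

(** Here the rows [L] and [M] are fixed. [ZR] carries no sign, so [tweval_scale] is applied with s =
    1. *)
Lemma right_eval F : functionary NR F -> pure F ->
  (forall Z' : 'M[R]_(size NR, kR + 4), tweval (twistor (B *m Z') (lrow Z')) F = 0) ->
  tweval (twistor (g *m (C *m Z)) (subst_right a b c d n (g *m (C *m Z)) z)) F = 0.
Proof.
move=> FN pF F0; have [e [f FE]] := tweval_scale n FN pF.
pose P : 'M[R]_(kL + 1 + kR + 4, (kR + 4) + (kL + 1)) :=
  col_mx (col_mx (row_mx 0 1%:M) (row_mx (row_mx 1%:M 0) 0)) (row_mx (row_mx 0 1%:M) 0).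
have [|ka [T PT]] := det_fixed_rows P (col_mx L M).
  by rewrite [RHS]addnC addnA.
rewrite (FE _ (twistor (B *m (ZR *m T)) (lrow (ZR *m T))) (\det g * ka) 1) ?F0 ?mulr0 //.
move=> I _ /allP IN; rewrite expr1n mulr1 twistor_mull -!mulrA; congr (_ * _).
rewrite /twistor; set W := (\matrix_r subst_right _ _ _ _ _ _ _ _); rewrite bcfw_mulE.
have -> : col_mx (col_mx (col_mx L M) Rr) W = P *m col_mx (col_mx Rr W) (col_mx L M).
  by rewrite !mul_col_mx !mul_row_col !mul1mx !mul0mx !addr0 !add0r.
rewrite PT mul_col_mx; congr (_ * \det (col_mx _ _)).
  by rewrite right_rowsE mulmxA.
apply/row_matrixP => r; rewrite row_mul !rowK subst_rightE lrow_mul lrow_rows //.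
by apply: IN; apply: mem_tnth.
Qed.
End Evaluation.
End BCFW.

(** * Continuity of product promotion *)

Section PsiLimits.
Context {R : realType} {k : nat}.
Variables (a b c d n : nat) (z : nat -> 'rV[R]_(k + 4)) (F : twpoly R).
Variable A0 : 'M[R]_(k, k + 4).

Let cvg_tw I : twistor A z I @[A --> A0] --> twistor A0 z I.
Proof.
apply: (@cvg_twistor R _ (nbhs A0) (nbhs_filter A0) k id A0 (fun=> z)); first exact: cvg_id.
by move=> x _; apply: (@cvg_mx R _ (nbhs A0) (nbhs_filter A0)) => i j; exact: cvg_cst.
Qed.

Let cvg_ratio I J : twistor A0 z J != 0 ->
  twistor A z I / twistor A z J @[A --> A0] --> twistor A0 z I / twistor A0 z J.
Proof.
move=> J0; exact: (@cvgM _ _ _ (nbhs_filter A0) _ _ _ _ (@cvg_tw I)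
  (@cvgV _ _ _ (nbhs_filter A0) _ _ J0 (@cvg_tw J))).
Qed.

(** The denominator enters only through coordinates containing b; if one occurs in [F], the domain
    condition makes the denominator nonzero. *)
Lemma subst_left_cvg :
  (occurs b F -> twistor A0 z [tuple a; c; d; n] != 0) ->
  tweval (twistor A (subst_left a b c d n A z)) F @[A --> A0] -->
  tweval (twistor A0 (subst_left a b c d n A0 z)) F.
Proof.
move=> dom; apply: (@cvg_tweval R _ (nbhs A0) (nbhs_filter A0)) => m mF I Im.
apply: (@cvg_twistor R _ (nbhs A0) (nbhs_filter A0) k id A0); first exact: cvg_id.
move=> x xI; rewrite /subst_left; case: eqP => [xb|_]; last first.
  by apply: (@cvg_mx R _ (nbhs A0) (nbhs_filter A0)) => i j; exact: cvg_cst.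
apply: (@cvg_mx R _ (nbhs A0) (nbhs_filter A0)) => i j; rewrite !mxE.
under eq_fun do rewrite !mxE.
apply: cvgB; first exact: cvg_cst.
apply: cvgM; last exact: cvg_cst.
by apply/cvg_ratio/dom; rewrite -xb; apply: occurs_mem mF Im xI.
Qed.

Lemma subst_right_cvg :
  (occurs n F -> twistor A0 z [tuple a; b; c; d] != 0) ->
  (occurs d F -> twistor A0 z [tuple a; b; c; n] != 0) ->
  tweval (twistor A (subst_right a b c d n A z)) F @[A --> A0] -->
  tweval (twistor A0 (subst_right a b c d n A0 z)) F.
Proof.
move=> domn domd; apply: (@cvg_tweval R _ (nbhs A0) (nbhs_filter A0)) => m mF I Im.
apply: (@cvg_twistor R _ (nbhs A0) (nbhs_filter A0) k id A0); first exact: cvg_id.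
move=> x xI; apply: (@cvg_mx R _ (nbhs A0) (nbhs_filter A0)) => i j.
rewrite /subst_right; case: eqP => [xn|_].
  have abcd0 : twistor A0 z [tuple a; b; c; d] != 0.
    by apply: domn; rewrite -xn; apply: occurs_mem mF Im xI.
  rewrite !mxE; under eq_fun do rewrite !mxE.
  apply: cvgD; first (apply: cvgB; first exact: cvg_cst).
    by apply: cvgM; [exact: cvg_ratio|exact: cvg_cst].
  by apply: cvgM; [exact: cvg_ratio|exact: cvg_cst].
case: eqP => [xd|_]; last exact: cvg_cst.
have abcn0 : twistor A0 z [tuple a; b; c; n] != 0.
  by apply: domd; rewrite -xd; apply: occurs_mem mF Im xI.
rewrite !mxE; under eq_fun do rewrite !mxE.
apply: cvgB; first exact: cvg_cst.
by apply: cvgM; [exact: cvg_ratio|exact: cvg_cst].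
Qed.
End PsiLimits.

(** * Vanishing of promoted functionaries *)

Section ProductPromotion.
Context {R : realType}.
Variables (N : seq nat) (a b c d n kL kR : nat).
Variables (SL : set (Gr R kL (size (N_left N a b n)))).
Variables (SR : set (Gr R kR (size (N_right N b d n)))).
Hypotheses (Nset : index_set N) (Nbcfw : bcfw_indices N a b c d n).
Hypotheses (SLcell : positroid_cell SL) (SRcell : positroid_cell SR).
Hypotheses (SLco : coindependent [:: a; b; n] SL).
Hypotheses (SRco : coindependent [:: b; c; d; n] SR).
Variables (Z : 'M[R]_(size N, kL + 1 + kR + 4)) (Zpos : Mat_pos Z).

(** The changes of representative before and after applying [Z] combine into one [g]; coindependence
    of both cells makes <<acdn>> nonzero. *)
Lemma reps_bcfw_product A : reps (tilde Z (bcfw_product c SL SR)) A ->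
  exists VL AL VR BR al be ga de ep, exists2 g, g \in unitmx &
    [/\ SL VL /\ represents VL AL, SR VR /\ represents VR BR,
        [/\ 0 < al, 0 < be, 0 < ga, 0 < de & 0 < ep],
        A = g *m (bcfw_mx c AL al be ga de ep BR *m Z) &
        twistor (bcfw_mx c AL al be ga de ep BR *m Z) (lrow Z) [tuple a; c; d; n] != 0].
Proof.
move=> [Y [W [C [[VL [AL [VR [BR [al [be [ga [de [ep [SVL SVR pos WM]]]]]]]]]] WC YC]]] YA].
have [g gu CE] := represents_eq WM WC; have [h hu AE] := represents_eq YC YA.
exists VL, AL, VR, BR, al, be, ga, de, ep, (h *m g); first by rewrite unitmx_mul hu.
split=> //; first by rewrite AE CE !mulmxA.
have [al0 be0 ga0 de0 ep0] := pos.
apply: tw_acdn_neq0 => //.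
  exact: coindependent_minor SLcell SLco SVL.1 SVL.2.
exact: coindependent_minor SRcell SRco SVR.1 SVR.2.
Qed.

(** On the image itself the promotion is defined and zero. Continuity on the domain carries this to
    the closure. *)
Lemma psi_left F : functionary (N_left N a b n) F -> pure F ->
  (forall Z' : 'M[R]_(size (N_left N a b n), kL + 4), Mat_pos Z' -> fvanishes Z' SL F) ->
  psi_left_vanishes a b c d n Z (bcfw_product c SL SR) F.
Proof.
move=> FN pF F0; apply: vanishes_on_closure => [A|A dom fA].
  move=> /reps_bcfw_product[VL [AL [VR [BR [al [be [ga [de [ep [g gu]]]]]]]]]].
  move=> [[SVL VLA] _ [al0 be0 ga0 de0 ep0] -> acdn0]; split.
    by move=> _; rewrite twistor_mull mulf_neq0 //; move: gu; rewrite unitmxE unitfE.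
  by apply: left_eval => //; apply: fvanishes_all F0 _ _ SVL VLA.
exact: cvgr_neq0 (subst_left_cvg dom) fA.
Qed.

Lemma psi_right F : functionary (N_right N b d n) F -> pure F ->
  (forall Z' : 'M[R]_(size (N_right N b d n), kR + 4), Mat_pos Z' -> fvanishes Z' SR F) ->
  psi_right_vanishes a b c d n Z (bcfw_product c SL SR) F.
Proof.
move=> FN pF F0; apply: vanishes_on_closure => [A|A [domn domd] fA].
  move=> /reps_bcfw_product[VL [AL [VR [BR [al [be [ga [de [ep [g gu]]]]]]]]]].
  move=> [_ [SVR VRB] [al0 be0 ga0 de0 ep0] -> acdn0]; split.
    have detg0 : \det g != 0 by move: gu; rewrite unitmxE unitfE.
    by split=> _; rewrite twistor_mull mulf_neq0 //;
      [apply: tw_abcd_neq0 acdn0|apply: tw_abcn_neq0 acdn0].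
  by apply: right_eval => //; apply: fvanishes_all F0 _ _ SVR VRB.
exact: cvgr_neq0 (subst_right_cvg domn domd) fA.
Qed.
End ProductPromotion.

Theorem theorem7p15 (R : realType) :
  (forall (k : nat) (N : seq nat) (S : set (Gr R k (size N))) (P Q : twpoly R),
     index_set N -> positroid_cell S ->
     functionary N P -> functionary N Q -> Q != 0 -> pure P -> pure Q ->
     (forall Z : 'M[R]_(size N, k + 4), Mat_pos Z -> rvanishes Z S P Q) ->
     [/\ forall I : seq nat, index_set I -> ~~ has (mem N) I ->
           forall Z : 'M[R]_(size (sort leq (N ++ I)), k + 4), Mat_pos Z ->
             rvanishes Z (pre I S) P Q,
         forall Z : 'M[R]_(size N, k + 4), Mat_pos Z ->
           rvanishes Z (cyc S) (cyc_star N P) (cyc_star N Q) &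
         forall Z : 'M[R]_(size N, k + 4), Mat_pos Z ->
           rvanishes Z (refl S) (refl_star N P) (refl_star N Q)])
  /\
  (forall (N : seq nat) (a b c d n kL kR : nat)
      (SL : set (Gr R kL (size (N_left N a b n))))
      (SR : set (Gr R kR (size (N_right N b d n)))),
     index_set N -> bcfw_indices N a b c d n ->
     positroid_cell SL -> positroid_cell SR ->
     coindependent [:: a; b; n] SL -> coindependent [:: b; c; d; n] SR ->
     (forall F : twpoly R,
        functionary (N_left N a b n) F -> pure F ->
        (forall Z : 'M[R]_(size (N_left N a b n), kL + 4),
           Mat_pos Z -> fvanishes Z SL F) ->
        forall Z : 'M[R]_(size N, kL + 1 + kR + 4), Mat_pos Z ->
          psi_left_vanishes a b c d n Z (bcfw_product c SL SR) F)
     /\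
     (forall F : twpoly R,
        functionary (N_right N b d n) F -> pure F ->
        (forall Z : 'M[R]_(size (N_right N b d n), kR + 4),
           Mat_pos Z -> fvanishes Z SR F) ->
        forall Z : 'M[R]_(size N, kL + 1 + kR + 4), Mat_pos Z ->
          psi_right_vanishes a b c d n Z (bcfw_product c SL SR) F)).
Proof.
split.
  move=> k N S P Q Nset _ NP NQ _ pP pQ vanS; split.
  - by move=> I Iset NI Z Zpos; apply: rvanishes_pre.
  - by move=> Z Zpos; apply: rvanishes_cyc.
  - by move=> Z Zpos; apply: rvanishes_refl.
move=> N a b c d n kL kR SL SR Nset Nbcfw SLcell SRcell SLco SRco; split.
  by move=> F FN pF F0 Z Zpos; apply: psi_left.
by move=> F FN pF F0 Z Zpos; apply: psi_right.
Qed.
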